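(* Let $q$ be an odd prime power, let $n \ge 3$ be an integer, and let $f(x,y,z)=x+yz$, viewed as a function from $M_n(\mathbb{F}_q)\times SL_n(\mathbb{F}_q)\times SL_n(\mathbb{F}_q)$ to $M_n(\mathbb{F}_q)$. There is a constant $c>0$ (independent of $q$ and of the sets below) such that for all $A\subset M_n(\mathbb{F}_q)$ and $B,C\subset SL_n(\mathbb{F}_q)$, \[ |f(A,B,C)| \ge c\,\min\left\{q^{n^2},\; q^{2n}|A|,\; \frac{|A||B|^2|C|^2}{q^{4n^2-4n-2}},\; \frac{|B||C|}{q^{n^2-n-1}}\right\}.\]
   Context: $M_n(\mathbb{F}_q)$ is the ring of $n\times n$ matrices over the finite field $\mathbb{F}_q$ and $SL_n(\mathbb{F}_q)$ the matrices of determinant $1$. For sets $A,B,C$, $f(A,B,C)=\{a+bc: a\in A, b\in B, c\in C\}$ (matrix product and sum). *)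

(* Defs.v *)
From HB Require Import structures.
From mathcomp Require Import all_boot all_order all_algebra.

Set Implicit Arguments.
Unset Strict Implicit.
Unset Printing Implicit Defensive.

Import GRing.Theory.
Local Open Scope ring_scope.

Definition SL (n : nat) (F : finFieldType) : {set 'M[F]_n} :=
  [set M : 'M[F]_n | \det M == 1].

Definition fxyz (n : nat) (F : finFieldType) (x y z : 'M[F]_n) : 'M[F]_n :=
  x + y *m z.

Definition fimage (n : nat) (F : finFieldType) (A B C : {set 'M[F]_n}) :
    {set 'M[F]_n} :=
  [set M : 'M[F]_n | [exists a in A, exists b in B, exists c in C,
                        M == fxyz a b c]].

(* Main.v *)
(* Let X = BC, a subset of SL_n; then A + X is contained in f(A, B, C) = S.

   Growth of X. For n >= 3 the group SL_n(F_q) is quasirandom: a function v on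
   it which is not constant is moved by some transvection, hence has a nonzero
   component for a nontrivial character of the group {1 + u e_j | u_j = 0}, an
   elementary abelian group of order q^(n-1); the stabiliser of e_j permutes its
   q^(n-1) - 1 nontrivial characters transitively, so the translates of v span
   at least that many orthogonal functions. Every nontrivial eigenvalue of
   convolution with 1_B thus has large multiplicity, and comparing with the
   Hilbert-Schmidt norm gives |X| >> min(q^(n^2-1), |B||C| / q^(n^2-n)).

   Growth of A + X. The Fourier coefficients of 1_{SL_n} on M_n(F_q) at M <> 0
   are O(q^(n^2-n-1)), so the expander mixing lemma for the graph joining a and s
   when s - a is in SL_n gives |S| >> min(q|X|, |A||X|^2 / q^(2n^2-2n-2)).

   Combining the two alternatives for X with the two for S yields the four terms
   of the minimum. *)
Require Import Defs.
From HB Require Import structures.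
From mathcomp Require Import all_boot all_order all_fingroup all_algebra reals.
From mathcomp Require Import algC classfun character sesquilinear spectral.
From mathcomp Require Import ring lra zify.

Set Implicit Arguments.
Unset Strict Implicit.
Unset Printing Implicit Defensive.

Import Order.TTheory GRing.Theory Num.Theory.
Local Open Scope ring_scope.
Local Open Scope sesquilinear_scope.

(** * Hermitian kernels on finite sets *)

(** Lagrange's identity: twice the difference of the two sides is a double sum of squares of real
    numbers. *)
Lemma CauchySchwarz_norm (I : finType) (P : pred I) (x y : I -> algC) :
  (\sum_(i | P i) `|x i| * `|y i|) ^+ 2 <=
  (\sum_(i | P i) `|x i| ^+ 2) * (\sum_(i | P i) `|y i| ^+ 2).
Proof.
rewrite -subr_ge0 -(pmulr_rge0 _ (ltr0n algC 2)).
have -> : 2%:R * ((\sum_(i | P i) `|x i| ^+ 2) * (\sum_(i | P i) `|y i| ^+ 2)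
    - (\sum_(i | P i) `|x i| * `|y i|) ^+ 2) =
  \sum_(i | P i) \sum_(j | P j) (`|x i| * `|y j| - `|x j| * `|y i|) ^+ 2.
  have sqE (a b c d : algC) :
    (a * b - c * d) ^+ 2 = a ^+ 2 * b ^+ 2 + d ^+ 2 * c ^+ 2 - 2%:R * (a * d * (c * b)).
    by ring.
  under [RHS]eq_bigr => i _ do under eq_bigr => j _ do rewrite sqE.
  under [RHS]eq_bigr => i _ do
    rewrite big_split sumrN big_split -!mulr_sumr /=.
  rewrite big_split sumrN big_split -!mulr_suml -!mulr_sumr -!mulr_suml /=.
  by ring.
apply: sumr_ge0 => i _; apply: sumr_ge0 => j _.
by rewrite real_exprn_even_ge0 // rpredB // rpredM ?normr_real.
Qed.

(** The difference of the two sides is the squared norm of [f - proj]. The [w i] are orthogonal but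
    not normalised, hence the division by their squared norms. *)
Lemma Bessel (T I : finType) (w : I -> T -> algC) (f : T -> algC) :
  (forall i, exists x, w i x != 0) ->
  (forall i j, i != j -> \sum_x w i x * (w j x)^* = 0) ->
  \sum_i `|\sum_x f x * (w i x)^*| ^+ 2 / (\sum_x `|w i x| ^+ 2)
    <= \sum_x `|f x| ^+ 2.
Proof.
move=> w_neq0 w_ortho; pose nw i := \sum_x `|w i x| ^+ 2.
have nw_gt0 i : 0 < nw i.
  have [x wx] := w_neq0 i; rewrite /nw (bigD1 x) //= ltr_wpDr ?exprn_gt0 ?normr_gt0 //.
  by apply: sumr_ge0 => y _; rewrite exprn_ge0.
pose c i := (\sum_x f x * (w i x)^*) / nw i.
have nwE i : \sum_x w i x * (w i x)^* = nw i.
  by apply: eq_bigr => x _; rewrite normCK.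
have nwJ i : (nw i)^* = nw i by rewrite geC0_conj ?ltW.
pose proj x := \sum_i c i * w i x.
have fproj : \sum_x f x * (proj x)^* = \sum_i `|c i| ^+ 2 * nw i.
  under eq_bigr => x _ do rewrite rmorph_sum mulr_sumr /=.
  rewrite exchange_big; apply: eq_bigr => i _ /=.
  under eq_bigr => x _ do rewrite rmorphM mulrCA.
  rewrite -mulr_sumr normCK mulrC /c -mulrA mulrCA -mulrA.
  by rewrite [in RHS]mulrCA [_^-1 * nw i]mulVf ?gt_eqF // mulr1 mulrC.
have projproj : \sum_x proj x * (proj x)^* = \sum_i `|c i| ^+ 2 * nw i.
  under eq_bigr => x _ do rewrite rmorph_sum mulr_suml /=.
  rewrite exchange_big; apply: eq_bigr => i _ /=.
  under eq_bigr => x _ do rewrite mulr_sumr.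
  rewrite exchange_big (bigD1 i) //= [X in _ + X]big1 ?addr0.
    under eq_bigr => x _ do rewrite rmorphM mulrACA -normCK.
    by rewrite -mulr_sumr nwE.
  move=> j ji; under eq_bigr => x _ do rewrite rmorphM mulrACA.
  by rewrite -mulr_sumr w_ortho ?mulr0 // eq_sym.
have -> : \sum_i `|\sum_x f x * (w i x)^*| ^+ 2 / nw i = \sum_i `|c i| ^+ 2 * nw i.
  apply: eq_bigr => i _; rewrite /c normf_div (ger0_norm (ltW (nw_gt0 i))).
  by field; rewrite gt_eqF ?nw_gt0.
rewrite -subr_ge0.
suff -> : \sum_x `|f x| ^+ 2 - \sum_i `|c i| ^+ 2 * nw i
   = \sum_x `|f x - proj x| ^+ 2.
  by apply: sumr_ge0 => x _; rewrite exprn_ge0.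
have projf : \sum_x proj x * (f x)^* = \sum_i `|c i| ^+ 2 * nw i.
  rewrite -[RHS]conj_Creal; last first.
    by rewrite ger0_real // sumr_ge0 // => i _; rewrite mulr_ge0 ?exprn_ge0 // ltW.
  rewrite -fproj rmorph_sum; apply: eq_bigr => x _.
  by rewrite rmorphM /= conjCK mulrC.
have -> : \sum_x `|f x - proj x| ^+ 2 = \sum_x `|f x| ^+ 2
    - \sum_x f x * (proj x)^* - \sum_x proj x * (f x)^*
    + \sum_x proj x * (proj x)^*.
  rewrite -!sumrB -big_split; apply: eq_bigr => x _ /=.
  by rewrite !normCK rmorphB; ring.
by rewrite fproj projf projproj subrK.
Qed.

(** Spectral theorem for the matrix of [k]. The eigenbasis comes with its completeness relation, the
    form needed to expand functions and kernels in it. *)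
Lemma hermitian_kernel_diag (T : finType) (k : T -> T -> algC) :
  (forall x y, k y x = (k x y)^*) ->
  exists (e : 'I_#|T| -> T -> algC) (d : 'I_#|T| -> algC),
    [/\ forall i, \sum_x `|e i x| ^+ 2 = 1,
        forall x y, \sum_i e i x * (e i y)^* = (x == y)%:R &
        forall i x, \sum_y k x y * e i y = d i * e i x].
Proof.
move=> k_herm; pose A := \matrix_(i, j) k (enum_val i) (enum_val j) : 'M_#|T|.
have /hermitian_normalmx/orthomx_spectralP : A \is hermsymmx.
  by apply/is_hermitianmxP/matrixP => i j; rewrite expr0 scale1r !mxE k_herm.
set U := spectralmx A; set D := spectral_diag A.
have Uu : U \is unitarymx := spectral_unitarymx A.
rewrite invmx_unitary // => AE.
have UU : U *m U ^t* = 1%:M by apply/unitarymxP.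
have UU' : U ^t* *m U = 1%:M by rewrite -invmx_unitary // mulVmx ?unitarymx_unit.
have AU : A *m U ^t* = U ^t* *m diag_mx D.
  by rewrite AE -!mulmxA UU mulmx1.
exists (fun i x => (U i (enum_rank x))^*), (fun i => D 0 i); split.
- move=> i; have := congr1 (fun M : 'M_#|T| => M i i) UU; rewrite !mxE eqxx mulr1n => <-.
  rewrite (reindex_onto enum_rank enum_val) /=; last by move=> j _; rewrite enum_valK.
  by apply: eq_big => [x|x _]; rewrite ?enum_rankK ?eqxx // norm_conjC normCK !mxE.
- move=> x y; have := congr1 (fun M : 'M_#|T| => M (enum_rank x) (enum_rank y)) UU'.
  rewrite !mxE (inj_eq enum_rank_inj) => <-; apply: eq_bigr => i _.
  by rewrite !mxE conjCK.
- move=> i x; have := congr1 (fun M : 'M_#|T| => M (enum_rank x) i) AU.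
  rewrite mul_mx_diag !mxE mulrC => <-.
  rewrite [RHS](reindex_onto enum_rank enum_val) /=; last by move=> j _; rewrite enum_valK.
  by apply: eq_big => [y|y _]; rewrite ?enum_rankK ?eqxx // !mxE !enum_rankK.
Qed.

(** * Product sets in quasirandom groups *)

(* In representation terms: every nontrivial representation of [gT] has
   dimension at least [D]; the [w i] are orthogonal vectors of the right
   submodule generated by [v]. *)
Definition quasirandom (gT : finGroupType) (D : nat) :=
  forall v : gT -> algC, (exists x, v x != 0) -> \sum_x v x = 0 ->
  exists (I : finType) (w : I -> gT -> algC),
    [/\ (D <= #|I|)%N,
        forall i, exists c : gT -> algC,
          forall x, w i x = \sum_g c g * v (x * g)%g,
        forall i, exists x, w i x != 0 &
        forall i j, i != j -> \sum_x w i x * (w j x)^* = 0].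

Lemma sum_mem_divg_r (gT : finGroupType) (B : {set gT}) (x : gT) :
  \sum_y (x * y^-1 \in B)%g%:R = #|B|%:R :> algC.
Proof.
rewrite -sum1_card natr_sum [RHS]big_mkcond.
rewrite (reindex_inj (h := fun y => y^-1 * x)%g) /=.
  by apply: eq_bigr => y _; rewrite invMg invgK mulKVg; case: (y \in B).
by move=> y z /mulIg/invg_inj.
Qed.

Lemma sum_mem_divg_l (gT : finGroupType) (B : {set gT}) (y : gT) :
  \sum_x (x * y^-1 \in B)%g%:R = #|B|%:R :> algC.
Proof.
rewrite -sum1_card natr_sum [RHS]big_mkcond (reindex_inj (mulIg y)) /=.
by apply: eq_bigr => x _; rewrite mulgK; case: (x \in B).
Qed.

(** * Spectral bound for convolution with the indicator of a set *)

Section ConvolutionOperator.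

Variables (gT : finGroupType) (D : nat) (B : {set gT}).
Hypothesis gT_qr : quasirandom gT D.

Let t (x y : gT) : algC := (x * y^-1 \in B)%g%:R.
Let T (h : gT -> algC) x := \sum_y t x y * h y.

Let tJ x y : (t x y)^* = t x y. Proof. exact: conjC_nat. Qed.

Let tM x y g : t (x * g)%g (y * g)%g = t x y.
Proof. by rewrite /t invMg mulgA mulgK. Qed.

Let sum_t_r x : \sum_y t x y = #|B|%:R. Proof. exact: sum_mem_divg_r. Qed.

Let sum_t_l y : \sum_x t x y = #|B|%:R. Proof. exact: sum_mem_divg_l. Qed.

(** Kernel of the adjoint of [T] composed with [T], minus its part on the constants, where the
    eigenvalue is [#|B| ^ 2]. *)
Let k (y y' : gT) := \sum_x t x y * t x y' - #|B|%:R ^+ 2 / #|gT|%:R.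

Let k_herm y y' : k y' y = (k y y')^*.
Proof.
rewrite /k rmorphB rmorph_sum /= [X in _ = _ - X]conj_Creal.
  by congr (_ - _); apply: eq_bigr => x _; rewrite rmorphM /= !tJ mulrC.
by rewrite rpredM ?rpredV ?rpredX ?realn.
Qed.

Let kM x y g : k (x * g)%g (y * g)%g = k x y.
Proof.
by congr (_ - _); rewrite (reindex_inj (mulIg g)); apply: eq_bigr => z _; rewrite !tM.
Qed.

Let card_gT_neq0 : #|gT|%:R != 0 :> algC.
Proof. by rewrite pnatr_eq0 -lt0n; apply/card_gt0P; exists 1%g. Qed.

Let sum_k y : \sum_x k x y = 0.
Proof.
rewrite sumrB exchange_big /=.
under eq_bigr => z _ do rewrite -mulr_suml sum_t_r.
by rewrite -mulr_sumr sum_t_l sumr_const -[X in _ - X]mulr_natr mulfVK // expr2 subrr.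
Qed.

Let k_T h y : \sum_x h x = 0 -> \sum_y' k y y' * h y' = \sum_x t x y * T h x.
Proof.
move=> h0; under eq_bigr => y' _ do rewrite mulrBl.
rewrite sumrB -[X in _ - X]mulr_sumr h0 mulr0 subr0.
under eq_bigr => y' _ do rewrite mulr_suml.
rewrite exchange_big; apply: eq_bigr => x _.
by rewrite mulr_sumr; apply: eq_bigr => y' _; rewrite mulrA.
Qed.

Let normT h : \sum_x h x = 0 ->
  \sum_x `|T h x| ^+ 2 = \sum_y (h y)^* * \sum_y' k y y' * h y'.
Proof.
move=> h0; under [RHS]eq_bigr => y _ do rewrite k_T // mulr_sumr.
rewrite exchange_big; apply: eq_bigr => x _ /=.
rewrite normCK mulrC rmorph_sum mulr_suml.
by apply: eq_bigr => y _; rewrite rmorphM /= tJ mulrCA mulrA.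
Qed.

(* The eigenspace of [d] is stable under right translations, hence contains
   [D] orthogonal vectors, while the Hilbert-Schmidt norm of [T] is
   [#|gT| * #|B|]. *)
Let eigenvalue_bound e d : \sum_x `|e x| ^+ 2 = 1 ->
  (forall x, \sum_y k x y * e y = d * e x) ->
  D%:R * d <= #|gT|%:R * #|B|%:R.
Proof.
move=> e1 ed; have [->|d_neq0] := eqVneq d 0.
  by rewrite mulr0 mulr_ge0 ?ler0n.
(* The columns of [k] sum to zero, so an eigenvector with [d != 0] has mean zero and quasirandomness
   applies to it. *)
have e_mean0 : \sum_x e x = 0.
  apply: (mulfI d_neq0); rewrite mulr0 mulr_sumr.
  under eq_bigr => x _ do rewrite -ed.
  rewrite exchange_big big1 // => y _.
  by rewrite -mulr_suml sum_k mul0r.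
have eigen_norm h : \sum_x h x = 0 -> (forall x, \sum_y k x y * h y = d * h x) ->
    \sum_x `|T h x| ^+ 2 = d * \sum_x `|h x| ^+ 2.
  move=> h0 hd; rewrite normT // mulr_sumr; apply: eq_bigr => y _.
  by rewrite hd normCK mulrCA [_^* * _]mulrC.
have d_ge0 : 0 <= d.
  by rewrite -[d]mulr1 -e1 -eigen_norm // sumr_ge0 // => x _; rewrite exprn_ge0.
have [|I [w [leDI w_span w_neq0 w_ortho]]] := gT_qr _ e_mean0.
  apply/existsP; apply: contraT; rewrite negb_exists => /forallP e0.
  move: e1; rewrite big1 => [/eqP|x _]; first by rewrite eq_sym oner_eq0.
  by move: (e0 x); rewrite negbK => /eqP ->; rewrite normr0 expr0n.
have w_mean0 i : \sum_x w i x = 0.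
  have [c wE] := w_span i; under eq_bigr => x _ do rewrite wE.
  rewrite exchange_big big1 // => g _; rewrite -mulr_sumr.
  suff -> : \sum_x e (x * g)%g = 0 by rewrite mulr0.
  by rewrite -[RHS]e_mean0 [RHS](reindex_inj (mulIg g)).
have w_eigen i x : \sum_y k x y * w i y = d * w i x.
  have [c wE] := w_span i; rewrite wE mulr_sumr.
  under eq_bigr => y _ do rewrite wE mulr_sumr.
  rewrite exchange_big; apply: eq_bigr => g _ /=.
  under eq_bigr => y _ do rewrite mulrCA.
  rewrite -mulr_sumr mulrCA -ed [in RHS](reindex_inj (mulIg g)) /=.
  by congr (_ * _); apply: eq_bigr => y _; rewrite kM.
have nw_gt0 i : 0 < \sum_x `|w i x| ^+ 2.
  have [x wx] := w_neq0 i; rewrite (bigD1 x) //= ltr_wpDr ?exprn_gt0 ?normr_gt0 //.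
  by apply: sumr_ge0 => y _; rewrite exprn_ge0.
apply: (@le_trans _ _ (#|I|%:R * d)).
  by rewrite ler_wpM2r // ler_nat.
(* Each quotient of squared norms equals [d]. For fixed [x], Bessel's inequality bounds the sum over
   [i] by the squared norm of the row [t x], which is [#|B|]. *)
have -> : #|I|%:R * d =
    \sum_i (\sum_x `|T (w i) x| ^+ 2) / \sum_x `|w i x| ^+ 2.
  rewrite mulr_natl -sumr_const; apply: eq_bigr => i _.
  by rewrite eigen_norm // mulfK ?gt_eqF.
under eq_bigr => i _ do rewrite mulr_suml.
rewrite exchange_big mulr_natl -sumr_const; apply: ler_sum => x _ /=.
rewrite -(sum_t_r x).
(* [T (w i) x] is the inner product of [t x] with the conjugate of [w i], so Bessel's inequality is
   applied to the conjugates. *)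
have wJ_neq0 i : exists y, (w i y)^* != 0.
  by have [y wy] := w_neq0 i; exists y; rewrite conjC_eq0.
have wJ_ortho i j : i != j -> \sum_y (w i y)^* * ((w j y)^*)^* = 0.
  move=> ij; rewrite -[LHS]conjCK rmorph_sum /=.
  under eq_bigr => y _ do rewrite rmorphM /= !conjCK.
  by rewrite w_ortho ?rmorph0.
have := Bessel (t x) wJ_neq0 wJ_ortho.
have -> : \sum_y `|t x y| ^+ 2 = \sum_y t x y.
  by apply: eq_bigr => y _; rewrite /t; case: (_ \in B); rewrite ?normr1 ?expr1n ?normr0 ?expr0n.
apply: le_trans; apply: ler_sum => i _; rewrite le_eqVlt; apply/orP; left; apply/eqP.
congr (`|_| ^+ 2 / _); apply: eq_bigr => y _; first by rewrite conjCK.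
by rewrite norm_conjC.
Qed.

(** In the eigenbasis of [k] the squared norms of [h] and of its convolution are the sums of the
    [|c i| ^ 2] with weights [1] and [d i], and [eigenvalue_bound] controls every [d i]. *)
Lemma convolution_operator_bound (h : gT -> algC) : \sum_x h x = 0 ->
  D%:R * \sum_x `|\sum_y (x * y^-1 \in B)%g%:R * h y| ^+ 2
    <= #|gT|%:R * #|B|%:R * \sum_x `|h x| ^+ 2.
Proof.
move=> h0; have [e [d [e1 e_complete e_eigen]]] := hermitian_kernel_diag k_herm.
have kE y y' : k y y' = \sum_i d i * (e i y * (e i y')^*).
  transitivity (\sum_z k y z * (z == y')%:R).
    rewrite (bigD1 y') //= eqxx mulr1 big1 ?addr0 // => z /negPf ->.
    by rewrite mulr0.
  under eq_bigr => z _ do rewrite -e_complete mulr_sumr.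
  rewrite exchange_big; apply: eq_bigr => i _ /=.
  by rewrite mulrA -e_eigen mulr_suml; apply: eq_bigr => z _; rewrite mulrA.
pose c i := \sum_x h x * (e i x)^*.
have cJ i : (c i)^* = \sum_y (h y)^* * e i y.
  by rewrite rmorph_sum; apply: eq_bigr => y _; rewrite rmorphM /= conjCK.
have -> : \sum_x `|h x| ^+ 2 = \sum_i `|c i| ^+ 2.
  transitivity (\sum_x \sum_y h x * (h y)^* * (y == x)%:R).
    apply: eq_bigr => x _; rewrite (bigD1 x) //= eqxx mulr1 big1 ?addr0 ?normCK //.
    by move=> y /negPf ->; rewrite mulr0.
  under eq_bigr => x _ do under eq_bigr => y _ do rewrite -e_complete mulr_sumr.
  under eq_bigr => x _ do rewrite exchange_big.
  rewrite exchange_big; apply: eq_bigr => i _ /=.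
  rewrite normCK cJ mulr_suml; apply: eq_bigr => x _.
  rewrite mulr_sumr; apply: eq_bigr => y _.
  by ring.
have := normT h0; rewrite /T => ->.
have -> : \sum_y (h y)^* * (\sum_y' k y y' * h y') = \sum_i d i * `|c i| ^+ 2.
  under eq_bigr => y _ do rewrite mulr_sumr.
  under eq_bigr => y _ do under eq_bigr => y' _ do
    rewrite kE mulr_suml mulr_sumr.
  under eq_bigr => y _ do rewrite exchange_big.
  rewrite exchange_big; apply: eq_bigr => i _ /=.
  rewrite normCK cJ mulrC mulr_suml mulr_suml exchange_big.
  apply: eq_bigr => x _ /=; rewrite mulr_sumr mulr_suml.
  by apply: eq_bigr => y _; ring.
rewrite mulr_sumr mulr_sumr; apply: ler_sum => i _; rewrite mulrA.
by rewrite ler_wpM2r ?exprn_ge0 // (eigenvalue_bound (e1 i)).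
Qed.

End ConvolutionOperator.

(** Let [r x] count the factorisations of [x] in [B * C]. By Cauchy-Schwarz, a small support of [r]
    forces a large second moment, while the operator bound keeps that moment close to [P ^ 2 / N],
    its value for constant [r]. *)
Lemma quasirandom_mulset (gT : finGroupType) (D : nat) (B C : {set gT}) :
  quasirandom gT D ->
  (D * #|gT| * (#|B| * #|C|) <= #|(B * C)%g| * (D * (#|B| * #|C|) + #|gT| ^ 2))%N.
Proof.
move=> gT_qr; set P := (#|B| * #|C|)%N; set N := #|gT|.
have [->|P_gt0] := posnP P; first by rewrite !muln0.
have N_gt0 : (0 < N)%N by apply/card_gt0P; exists 1%g.
have N_neq0 : N%:R != 0 :> algC by rewrite pnatr_eq0 -lt0n.
pose t (x y : gT) : algC := (x * y^-1 \in B)%g%:R.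
pose r x := \sum_(y in C) t x y.
have r_ge0 x : 0 <= r x by apply: sumr_ge0 => y _; rewrite ler0n.
have sum_r : \sum_x r x = P%:R.
  rewrite exchange_big /=; under eq_bigr => y _ do rewrite sum_mem_divg_l.
  by rewrite sumr_const -[LHS]mulr_natr -natrM.
have r_supp x : x \notin (B * C)%g -> r x = 0.
  move=> xBC; apply: big1 => y Cy; rewrite /t; case: (boolP (_ \in B)) => // Bxy.
  by move: xBC; rewrite -(mulgKV y x) mem_mulg.
(* [m] is the density of [C]; subtracting it makes [h] mean-zero, as the operator bound requires. *)
pose m : algC := #|C|%:R / N%:R.
pose h y : algC := (y \in C)%:R - m.
have sumC : \sum_y (y \in C)%:R = #|C|%:R :> algC.
  by rewrite -sum1_card natr_sum [RHS]big_mkcond; apply: eq_bigr => y _; case: (y \in C).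
have sum_m : \sum_(y : gT) m = #|C|%:R.
  by rewrite sumr_const -[LHS]mulr_natr /m mulfVK.
have h0 : \sum_y h y = 0 by rewrite sumrB sumC sum_m subrr.
have mR : m \is Num.real by rewrite rpredM ?rpredV ?realn.
have normh : \sum_x `|h x| ^+ 2 <= #|C|%:R.
  have -> : \sum_x `|h x| ^+ 2 = #|C|%:R - m * #|C|%:R.
    transitivity (\sum_x ((x \in C)%:R * (1 - 2%:R * m) + m * m)).
      apply: eq_bigr => x _; rewrite real_normK ?rpredB ?realn // /h.
      by case: (x \in C) => /=; ring.
    by rewrite big_split -mulr_suml sumC -mulr_sumr sum_m /=; ring.
  by rewrite gerBl mulr_ge0 // divr_ge0.
have Th x : \sum_y t x y * h y = r x - P%:R / N%:R.
  under eq_bigr => y _ do rewrite mulrBr.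
  rewrite sumrB -mulr_suml sum_mem_divg_r /P natrM mulrA; congr (_ - _).
  by rewrite /r [RHS]big_mkcond; apply: eq_bigr => y _; case: (y \in C); rewrite ?mulr1 ?mulr0.
have normTh : \sum_x `|\sum_y t x y * h y| ^+ 2 = \sum_x r x ^+ 2 - P%:R ^+ 2 / N%:R.
  transitivity (\sum_x (r x ^+ 2 - (2%:R * (P%:R / N%:R)) * r x + (P%:R / N%:R) ^+ 2)).
    apply: eq_bigr => x _; rewrite Th real_normK; first by ring.
    by rewrite rpredB ?ger0_real // divr_ge0.
  rewrite big_split sumrB -mulr_sumr sum_r sumr_const -[X in _ + X = _]mulr_natr /=.
  by rewrite -/N; field.
have := convolution_operator_bound B gT_qr h0; rewrite normTh -/N => bound.
have CS : P%:R ^+ 2 <= #|(B * C)%g|%:R * \sum_x r x ^+ 2.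
  have := CauchySchwarz_norm (mem (B * C)%g) (fun=> 1) r.
  under eq_bigr do rewrite normr1 mul1r ger0_norm //.
  have -> : \sum_(x in (B * C)%g) r x = P%:R.
    by rewrite -sum_r [RHS](bigID (mem (B * C)%g)) /= [X in _ = _ + X]big1 ?addr0.
  move=> /le_trans; apply.
  under eq_bigr do rewrite normr1 expr1n.
  rewrite sumr_const ler_wpM2l ?ler0n //.
  under eq_bigr do rewrite ger0_norm //.
  rewrite [leRHS](bigID (mem (B * C)%g)) /= lerDl.
  by apply: sumr_ge0 => x _; rewrite exprn_ge0.
rewrite -(leq_pmul2r P_gt0) -(ler_nat algC).
have bound' : D%:R * N%:R * \sum_x r x ^+ 2 <= D%:R * P%:R ^+ 2 + N%:R ^+ 2 * P%:R.
  rewrite addrC -lerBlDr.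
  have -> : D%:R * N%:R * (\sum_x r x ^+ 2) - D%:R * P%:R ^+ 2
     = N%:R * (D%:R * (\sum_x r x ^+ 2 - P%:R ^+ 2 / N%:R)) by field.
  apply: le_trans (ler_wpM2l (ler0n _ _) bound) _.
  rewrite expr2 -!mulrA !ler_wpM2l ?ler0n // /P natrM.
  by rewrite ler_wpM2l ?ler0n.
have -> : (D * N * P * P)%:R = D%:R * N%:R * P%:R ^+ 2 :> algC.
  by rewrite !natrM; ring.
apply: le_trans (ler_wpM2l _ CS) _; first by rewrite mulr_ge0 ?ler0n.
rewrite mulrCA -mulnA natrM ler_wpM2l ?ler0n //.
suff -> : ((D * P + N ^ 2) * P)%:R = D%:R * P%:R ^+ 2 + N%:R ^+ 2 * P%:R :> algC by [].
by rewrite mulnDl natrD !natrM; ring.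
Qed.

(** * Additive characters of finite fields *)

Definition nontrivial_addchar (F : finFieldType) (psi : F -> algC) :=
  [/\ {morph psi : x y / x + y >-> x * y}, forall x, `|psi x| = 1 &
      exists a, psi a != 1].

(** The additive group is abelian, so its irreducible characters are linear and there are [#|F| > 1]
    of them. Index [0] is the principal one, so index [1] is taken. *)
Lemma nontrivial_addchar_exists (F : finFieldType) :
  exists psi : F -> algC, nontrivial_addchar psi.
Proof.
pose G := [set: F]%G.
have Gab : abelian G.
  by apply/centsP => x _ y _; rewrite /commute !FinRing.zmodMgE addrC.
have chi_lin i : 'chi[G]_i \is a linear_char by apply/char_abelianP.
have G_gt1 : (1 < Nirr G)%N.
  rewrite NirrE; have := card_classes_abelian G; rewrite Gab => /esym/eqP ->.
  by rewrite cardsT card_finNzRing_gt1.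
pose i : Iirr G := Ordinal G_gt1.
exists 'chi_i; split.
- by move=> x y; rewrite -lin_charM ?inE ?FinRing.zmodMgE.
- by move=> x; rewrite normC_lin_char ?inE.
- have : i != 0 by [].
  move=> i0; apply/existsP; move: i0; apply: contraNT; rewrite negb_exists => /forallP chi1.
  apply/eqP/irr_inj; rewrite irr0; apply/cfunP => x; rewrite cfun1E inE.
  by apply/eqP; rewrite -[_ == _]negbK.
Qed.

Section AdditiveCharacter.

Variables (F : finFieldType) (psi : F -> algC).
Hypothesis psi_char : nontrivial_addchar psi.

Lemma addcharD x y : psi (x + y) = psi x * psi y.
Proof. by case: psi_char => psiD _ _; rewrite psiD. Qed.

Lemma addchar_norm x : `|psi x| = 1.
Proof. by case: psi_char. Qed.

Lemma addchar_neq0 x : psi x != 0.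
Proof. by rewrite -normr_eq0 addchar_norm oner_eq0. Qed.

Lemma addchar0 : psi 0 = 1.
Proof. by apply: (mulfI (addchar_neq0 0)); rewrite -addcharD addr0 mulr1. Qed.

Lemma addcharN x : psi (- x) = (psi x)^*.
Proof.
apply: (mulfI (addchar_neq0 x)).
by rewrite -addcharD subrr addchar0 -normCK addchar_norm expr1n.
Qed.

Lemma addchar_scale_neq1 x : x != 0 -> exists a, psi (a * x) != 1.
Proof.
case: psi_char => _ _ [a psi_a] x0; exists (a / x).
by rewrite mulfVK.
Qed.

(** Translation by [t] preserves the sum and also multiplies it by [c]. The orthogonality relations
    for [psi] are deduced from this. *)
Lemma sum_shift_eq0 (V : finZmodType) (A : {pred V}) (f : V -> algC) (t : V) (c : algC) :
  (forall x, (x + t \in A) = (x \in A)) -> (forall x, f (x + t) = c * f x) ->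
  c != 1 -> \sum_(x in A) f x = 0.
Proof.
move=> At ft c1; have : \sum_(x in A) f x = c * \sum_(x in A) f x.
  rewrite [LHS](reindex_inj (addIr t)) mulr_sumr.
  by apply: eq_big => [x|x _]; rewrite ?At ?ft.
move/eqP; rewrite -subr_eq0 -{1}[\sum_(x in A) f x]mul1r -mulrBl mulf_eq0.
by rewrite subr_eq0 eq_sym (negPf c1) => /eqP.
Qed.

Lemma sum_addchar_mul (m : nat) (y : 'rV[F]_m) :
  \sum_(w : 'cV[F]_m) psi ((y *m w) 0 0) = (y == 0)%:R * (#|F| ^ m)%:R.
Proof.
have [->|y0] := eqVneq y 0.
  under eq_bigr do rewrite mul0mx mxE addchar0.
  by rewrite sumr_const mul1r card_mx muln1.
have [k yk] : exists k, y 0 k != 0 by apply/rV0Pn.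
have [a psia] := addchar_scale_neq1 yk.
rewrite mul0r (sum_shift_eq0 (t := a *: delta_mx k 0) _ _ psia) // => w.
by rewrite mulmxDr mxE addcharD mulrC -scalemxAr -colE !mxE.
Qed.

(** The trace form is nondegenerate: if [X i j != 0], shifting [M] by a suitable multiple of
    [delta_mx j i] multiplies each term by a constant other than 1. *)
Lemma sum_addchar_trace (n : nat) (X : 'M[F]_n) :
  \sum_(M : 'M[F]_n) psi (\tr (M *m X)) = (X == 0)%:R * (#|F| ^ (n ^ 2))%:R.
Proof.
have [->|X0] := eqVneq X 0.
  under eq_bigr do rewrite mulmx0 mxtrace0 addchar0.
  by rewrite sumr_const mul1r card_mx.
have [i [j Xij]] : exists i, exists j, X i j != 0.
  by apply/matrix0Pn.
have [a psia] := addchar_scale_neq1 Xij.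
rewrite mul0r (sum_shift_eq0 (t := a *: delta_mx j i) _ _ psia) // => M.
rewrite mulmxDl mxtraceD addcharD mulrC -scalemxAl mxtraceZ; congr (psi (_ * _) * _).
rewrite -(mul_delta_mx (0 : 'I_1)) -mulmxA mxtrace_mulC -rowE -colE.
by rewrite /mxtrace big_ord1 !mxE.
Qed.

End AdditiveCharacter.

(** * Generation by transvections *)

(** Both [L *m A] and [A *m L] are block upper triangular, and they have the same determinant. *)
Lemma det_1_add_col_row (R : comUnitRingType) (n : nat) (u : 'cV[R]_n) (w : 'rV[R]_n) :
  \det (1%:M + u *m w) = 1 + (w *m u) 0 0.
Proof.
pose A := block_mx 1%:M w (- u) 1%:M : 'M_(1 + n).
pose L := block_mx 1%:M 0 u 1%:M : 'M_(1 + n).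
have detL : \det L = 1 by rewrite det_lblock !det1 mulr1.
have -> : \det (1%:M + u *m w) = \det (L *m A).
  rewrite mulmx_block !mul1mx !mul0mx !mulmx1 !addr0 subrr det_ublock det1 mul1r.
  by rewrite addrC.
rewrite det_mulmx mulrC -det_mulmx mulmx_block !mul1mx !mulmx1 !mulmx0 !add0r.
rewrite addNr det_ublock det1 mulr1 [X in \det X]mx11_scalar det_scalar1.
by rewrite mxE mxE eqxx.
Qed.

Lemma transvectionE (F : fieldType) (n p : nat) (i j : 'I_n) (a : F) (h : 'M_(n, p)) k l :
  ((1%:M + a *: delta_mx i j) *m h) k l = h k l + (k == i)%:R * a * h j l.
Proof.
rewrite mulmxDl mul1mx -scalemxAl !mxE (bigD1 j) //= big1 => [|m /negPf mj].
  by rewrite mxE eqxx andbT addr0 mulrCA mulrA.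
by rewrite mxE mj andbF mul0r.
Qed.

Lemma det_transvection (F : fieldType) (n : nat) (i j : 'I_n) (a : F) : i != j ->
  \det (1%:M + a *: delta_mx i j) = 1.
Proof.
move=> ij; rewrite -(mul_delta_mx (0 : 'I_1)) scalemxAl det_1_add_col_row.
by rewrite -scalemxAr mul_delta_mx_0 1?eq_sym // scaler0 mxE addr0.
Qed.

(** Gaussian elimination, by induction on the size. Stating it for a multiplicative predicate [H]
    lets it be applied directly to the property of fixing a function. *)
Lemma SL_generation (F : fieldType) (n : nat) (H : 'M[F]_n -> Prop) :
  H 1%:M -> (forall g h, H g -> H h -> H (g *m h)) ->
  (forall i j a, i != j -> H (1%:M + a *: delta_mx i j)) ->
  forall g, \det g = 1 -> H g.
Proof.
elim: n H => [|n IHn]; last rewrite -[n.+1]/(1 + n)%N.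
  by move=> H H1 _ _ g _; rewrite [g]flatmx0 -[0](flatmx0 1%:M).
move=> H H1 HM Hel g detg.
have Hcancel i j a h : i != j -> H ((1%:M + a *: delta_mx i j) *m h) -> H h.
  move=> ij Hh.
  suff -> : h = (1%:M + (- a) *: delta_mx i j) *m ((1%:M + a *: delta_mx i j) *m h).
    by apply: HM => //; apply: Hel.
  rewrite mulmxA mulmxDl mul1mx mulmxDr mulmx1 -scalemxAl -scalemxAr.
  rewrite mul_delta_mx_0 1?eq_sym // !scaler0 addr0 scaleNr.
  by rewrite -addrA subrr addr0 mul1mx.
have Hlow (z : 'cV_n) : H (block_mx 1%:M 0 z 1%:M : 'M_(1 + n)).
  rewrite [z]matrix_sum_delta; elim/big_ind: _ => [|x y Hx Hy|i _].
  - by rewrite -scalar_mx_block.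
  - have := HM _ _ Hx Hy.
    by rewrite mulmx_block !mul1mx !mul0mx !mulmx1 !mulmx0 !addr0 !add0r.
  - rewrite big_ord1; have := Hel (rshift 1 i) (lshift n 0) (z i 0).
    rewrite delta_mx_lshift delta_mx_dshift -[0 : 'M_(1 + n, n)]col_mx0 -block_mxEh.
    rewrite scale_block_mx !scaler0 scalar_mx_block add_block_mx !addr0 add0r.
    by apply; rewrite eq_rlshift.
have Hup (y : 'rV_n) : H (block_mx 1%:M y 0 1%:M : 'M_(1 + n)).
  rewrite [y]matrix_sum_delta big_ord1; elim/big_ind: _ => [|x x' Hx Hx'|i _].
  - by rewrite -scalar_mx_block.
  - have := HM _ _ Hx Hx'.
    rewrite mulmx_block !mul1mx !mul0mx !mulmx1 !mulmx0 !addr0 !add0r.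
    by rewrite addrC.
  - have := Hel (lshift n 0) (rshift 1 i) (y 0 i).
    rewrite delta_mx_rshift delta_mx_ushift -[0 : 'M_(1 + n, 1)]col_mx0 -block_mxEh.
    rewrite scale_block_mx !scaler0 scalar_mx_block add_block_mx !addr0 add0r.
    by apply; rewrite eq_lrshift.
have Hdr (h : 'M_n) : \det h = 1 -> H (block_mx 1%:M 0 0 h : 'M_(1 + n)).
  apply: (IHn (fun h => H (block_mx 1%:M 0 0 h : 'M_(1 + n)))).
  - by rewrite -scalar_mx_block.
  - move=> h1 h2 Hh1 Hh2; have := HM _ _ Hh1 Hh2.
    by rewrite mulmx_block !mul1mx !mul0mx !mulmx0 !addr0 !add0r.
  - move=> i j a ij; have := Hel (rshift 1 i) (rshift 1 j) a.
    rewrite delta_mx_rshift delta_mx_dshift -[0 : 'M_(1 + n, 1)]col_mx0 -block_mxEh.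
    rewrite scale_block_mx !scaler0 scalar_mx_block add_block_mx !addr0.
    by apply; rewrite eq_rshift.
have Hul1 (h : 'M_(1 + n)) : \det h = 1 -> h 0 0 = 1 -> H h.
  move=> deth h00; rewrite -[h]submxK.
  have -> : ulsubmx h = 1%:M.
    by rewrite [LHS]mx11_scalar !mxE lshift0 h00.
  set y := ursubmx h; set z := dlsubmx h; set k := drsubmx h.
  (* Block LDU factorisation; the Schur complement [k - z *m y] has determinant 1 and falls under
     the induction hypothesis. *)
  have hE : block_mx 1%:M y z k =
      block_mx 1%:M 0 z 1%:M *m (block_mx 1%:M 0 0 (k - z *m y) *m block_mx 1%:M y 0 1%:M).
    rewrite !mulmx_block !mul1mx !mul0mx !mulmx1 !mulmx0 !addr0 !add0r.
    by rewrite addrCA subrr addr0 mulmx1.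
  have detk : \det (k - z *m y) = 1.
    have hE' : h = block_mx 1%:M y z k.
      rewrite -[LHS]submxK; congr (block_mx _ _ _ _).
      by rewrite [LHS]mx11_scalar !mxE lshift0 h00.
    move: deth; rewrite hE' hE !det_mulmx !det_lblock det_ublock !det1.
    by rewrite !mul1r !mulr1.
  by rewrite hE; apply: HM (Hlow _) (HM _ _ (Hdr _ detk) (Hup _)).
have Hdl (h : 'M_(1 + n)) (i : 'I_n) : \det h = 1 -> h (rshift 1 i) 0 != 0 -> H h.
  (* [a] is chosen so that adding [a] times the row [rshift 1 i] to row 0 turns the corner entry
     into 1. *)
  move=> deth hi0; pose a := (1 - h 0 0) / h (rshift 1 i) 0.
  have ij : lshift n 0 != rshift 1 i :> 'I_(1 + n) by rewrite eq_lrshift.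
  apply: (Hcancel _ _ a _ ij); apply: Hul1; first by rewrite det_mulmx deth mulr1 det_transvection.
  by rewrite transvectionE lshift0 eqxx mul1r /a mulfVK // addrC subrK.
have [/existsP[i hi0]|] := boolP [exists i, g (rshift 1 i) 0 != 0]; first exact: (Hdl _ i).
rewrite negb_exists => /forallP g0.
have [|g00] := eqVneq (g 0 0) 1; first exact: Hul1.
have [n0|n_gt0] := posnP n.
  have det11 m (h : 'M[F]_(1 + m)) : m = 0%N -> \det h = h 0 0.
    by move=> m0; move: h; rewrite m0 => h; rewrite [in LHS](mx11_scalar h) det_scalar1.
  by case/eqP: g00; rewrite -det11.
(* The first column vanishes below the corner. The corner itself is nonzero since [\det g = 1], so
   adding row 0 to another row creates the entry that [Hdl] needs. *)
pose i0 := Ordinal n_gt0.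
have ij : rshift 1 i0 != lshift n 0 :> 'I_(1 + n) by rewrite eq_rlshift.
apply: (Hcancel _ _ 1 _ ij); apply: (Hdl _ i0).
  by rewrite det_mulmx detg mulr1 det_transvection.
rewrite transvectionE eqxx !mul1r lshift0 (eqP (negbNE (g0 i0))) add0r.
apply: contraTneq isT => g00'; have : \det g = 0; last first.
  by rewrite detg => /eqP; rewrite oner_eq0.
rewrite (expand_det_col _ 0) big1 // => i _.
case: (unliftP 0 i) => [k ->|->]; last by rewrite g00' mul0r.
have /negPn/eqP := g0 k; rewrite (_ : rshift 1 k = lift 0 k); last exact: val_inj.
by move=> ->; rewrite mul0r.
Qed.

(** * Quasirandomness of the special linear group *)

Definition slmx (F : finFieldType) (n : nat) := {M : 'M[F]_n | \det M == 1}.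

Section SpecialLinearGroup.

Variables (F : finFieldType) (n : nat).
Implicit Types x y z : slmx F n.

HB.instance Definition _ := Finite.on (slmx F n).

Lemma slmx_det x : \det (val x) = 1. Proof. exact/eqP/(valP x). Qed.

Lemma slmx_unit x : val x \in unitmx.
Proof. by rewrite unitmxE slmx_det unitr1. Qed.

(** Total by convention: a matrix of determinant other than 1 is sent to the identity. *)
Definition slmx_mk (M : 'M[F]_n) : slmx F n :=
  insubd (exist _ 1%:M (introT eqP (det1 F n))) M.

Lemma slmx_mkK (M : 'M[F]_n) : \det M = 1 -> val (slmx_mk M) = M.
Proof. by move=> detM; rewrite val_insubd detM eqxx. Qed.

Let mul x y := slmx_mk (val x *m val y).
Let one := slmx_mk 1%:M.
Let inv x := slmx_mk (invmx (val x)).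

Let val_mul x y : val (mul x y) = val x *m val y.
Proof. by rewrite slmx_mkK // det_mulmx !slmx_det mulr1. Qed.

Let val_one : val one = 1%:M. Proof. by rewrite slmx_mkK ?det1. Qed.

Let val_inv x : val (inv x) = invmx (val x).
Proof. by rewrite slmx_mkK // det_inv slmx_det invr1. Qed.

Let mulA : associative mul.
Proof. by move=> x y z; apply: val_inj; rewrite !val_mul mulmxA. Qed.

Let mul1 : left_id one mul.
Proof. by move=> x; apply: val_inj; rewrite val_mul val_one mul1mx. Qed.

Let mulV : left_inverse one inv mul.
Proof.
by move=> x; apply: val_inj; rewrite val_mul val_one val_inv mulVmx ?slmx_unit.
Qed.

HB.instance Definition _ := Finite_isGroup.Build (slmx F n) mulA mul1 mulV.

Lemma val_slmxM x y : val (x * y)%g = val x *m val y.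
Proof. exact: val_mul. Qed.

Lemma val_slmx1 : val (1%g : slmx F n) = 1%:M.
Proof. exact: val_one. Qed.

End SpecialLinearGroup.

(** * Orthogonal translates of a mean-zero function on the special linear group *)

Section SLQuasirandom.

Variables (F : finFieldType) (m : nat).
Local Notation n := m.+1.

Variable v : slmx F n -> algC.
Hypotheses (v_neq0 : exists x, v x != 0) (v_mean0 : \sum_x v x = 0).

Let transl (i j : 'I_n) (a : F) := slmx_mk (1%:M + a *: delta_mx i j).

(** If every transvection fixed [v], generation would make [v] constant, and mean zero would make it
    vanish. *)
Lemma transvection_moves : exists i j a x, i != j /\ v (x * transl i j a)%g != v x.
Proof.
have [|] := boolP [exists i, exists j, exists a, exists x,
    (i != j) && (v (x * transl i j a)%g != v x)].
  case/existsP=> i /existsP[j] /existsP[a] /existsP[x] /andP[ij vx].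
  by exists i, j, a, x.
move=> no_move; have v_inv i j a x : i != j -> v (x * transl i j a)%g = v x.
  move=> ij; apply/eqP; apply: contraNT no_move => vx.
  apply/existsP; exists i; apply/existsP; exists j; apply/existsP; exists a.
  by apply/existsP; exists x; rewrite ij.
pose H (M : 'M[F]_n) := \det M = 1 /\ forall x, v (x * slmx_mk M)%g = v x.
have HG : forall g, \det g = 1 -> H g.
  apply: SL_generation => [|g h [detg Hg] [deth Hh]|i j a ij].
  - split=> [|x]; first exact: det1.
    by congr v; rewrite -[RHS]mulg1; congr (_ * _)%g; apply: val_inj;
       rewrite val_slmx1 slmx_mkK ?det1.
  - split=> [|x]; first by rewrite det_mulmx detg deth mulr1.
    rewrite -[RHS]Hg -[RHS]Hh -mulgA; congr (v (_ * _)%g); apply: val_inj.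
    by rewrite val_slmxM !slmx_mkK // det_mulmx detg deth mulr1.
  - by split=> [|x]; [rewrite det_transvection | apply: v_inv].
have v_const x : v x = v 1%g.
  have [_ /(_ 1%g)] := HG _ (slmx_det x); rewrite mul1g => <-; congr v.
  by apply: val_inj; rewrite slmx_mkK ?slmx_det.
have [x vx] := v_neq0; case/eqP: vx; rewrite v_const.
have := v_mean0; under eq_bigr do rewrite v_const.
rewrite sumr_const => /eqP; rewrite mulrn_eq0 => /orP[/eqP card0|/eqP //].
by have := fintype0 x card0.
Qed.

Variables (psi : F -> algC) (j : 'I_n).
Hypotheses (psi_char : nontrivial_addchar psi) (m_gt1 : (2 <= m)%N).

(** For [u] in [U] one has [w *m u = 0], so the [T u] have determinant 1 and multiply as the [u]
    add. The rows in [P] parametrise the characters of this abelian group. *)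
Let w : 'rV[F]_n := delta_mx 0 j.
Let U : {pred 'cV[F]_n} := [pred u : 'cV[F]_n | u j 0 == 0].
Let P : {pred 'rV[F]_n} := [pred p : 'rV[F]_n | p 0 j == 0].
Let T (u : 'cV[F]_n) := slmx_mk (1%:M + u *m w).

Let mul_w u : w *m u = (u j 0)%:M.
Proof. by rewrite -rowE [LHS]mx11_scalar mxE. Qed.

Let val_T u : u \in U -> val (T u) = 1%:M + u *m w.
Proof.
by move=> /eqP uj; rewrite slmx_mkK // det_1_add_col_row mul_w uj mxE mul0rn addr0.
Qed.

Let TD u u' : u \in U -> u' \in U -> T (u + u') = (T u * T u')%g.
Proof.
move=> Uu Uu'; apply: val_inj; rewrite val_slmxM !val_T //.
  have wuw0 : u *m w *m (u' *m w) = 0.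
    by rewrite -mulmxA [w *m _]mulmxA mul_w (eqP Uu') raddf0 mul0mx mulmx0.
  rewrite [(_ + _) *m (_ + _)]mulmxDl mul1mx mulmxDr mulmx1 wuw0 addr0.
  by rewrite mulmxDl -addrA [u' *m w + _]addrC.
by rewrite inE mxE (eqP Uu) (eqP Uu') addr0.
Qed.

(* [component p g x] is the component of the translate [v (_ * g)] on which the
   abelian group [{T u | u in U}] acts through the character [u |-> psi (p u)]. *)
Let component (p : 'rV[F]_n) (g x : slmx F n) :=
  \sum_(u in U) psi (- (p *m u) 0 0) * v (x * T u * g)%g.

Let componentT p g x u : u \in U ->
  component p g (x * T u)%g = psi ((p *m u) 0 0) * component p g x.
Proof.
move=> Uu; rewrite /component mulr_sumr [RHS](reindex_inj (addrI u)) /=.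
apply: eq_big => [u'|u' Uu'].
  by rewrite !inE mxE (eqP Uu) add0r.
rewrite -[(x * T u * T u')%g]mulgA -TD // mulrA -(addcharD psi_char).
by congr (psi _ * _); rewrite mulmxDr [X in _ - X]mxE opprD addNKr.
Qed.

Let active p := exists g x, component p g x != 0.

(** If only the trivial character contributed, Fourier inversion would make [v] a multiple of
    [component 0 1%g], which is invariant under every [T u], including the given transvection. *)
Let active_exists i a x : i != j -> v (x * transl i j a)%g != v x ->
  exists2 p, p \in P & p != 0 /\ active p.
Proof.
move=> ij vx; have [/existsP[p]|] := boolP [exists p, [&& p \in P, p != 0 &
     [exists g, [exists x, component p g x != 0]]]].
  case/and3P=> Pp p0 /existsP[g /existsP[y cy]].
  by exists p => //; split=> //; exists g, y.
move=> none; case/eqP: vx.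
have comp0 p y : p \in P -> p != 0 -> component p 1%g y = 0.
  move=> Pp p0; apply/eqP; apply: contraNT none => cy.
  apply/existsP; exists p; rewrite Pp p0; apply/existsP; exists 1%g.
  by apply/existsP; exists y.
have inversion y : #|P|%:R * v y = component 0 1%g y.
  transitivity (\sum_(p in P) component p 1%g y); last first.
    rewrite (bigD1 0) /= ?inE ?mxE // [X in _ + X]big1 ?addr0 // => p /andP[].
    exact: comp0.
  rewrite exchange_big (bigD1 0) /= ?inE ?mxE //.
  rewrite [X in _ + X]big1 ?addr0 => [|u /andP[Uu u0]].
    under eq_bigr do rewrite mulmx0 mxE oppr0 (addchar0 psi_char) mul1r.
    rewrite sumr_const mulg1 -[RHS]mulr_natl; congr (_ * v _).
    rewrite -[LHS]mulg1; congr (_ * _)%g; apply: val_inj.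
    by rewrite val_T ?inE ?mxE // mul0mx addr0 val_slmx1.
  rewrite -mulr_suml; apply/eqP; rewrite mulf_eq0; apply/orP; left; apply/eqP.
  have /cV0Pn[k uk] := u0.
  have [b psib] := addchar_scale_neq1 psi_char (x := - u k 0) ltac:(by rewrite oppr_eq0).
  apply: (sum_shift_eq0 (t := b *: delta_mx 0 k) _ _ psib) => p.
    rewrite !inE !mxE; have [kj|_] := eqVneq j k; last by rewrite mulr0 addr0.
    by case/eqP: uk; rewrite -kj; apply/eqP.
  by rewrite mulmxDl mxE opprD (addcharD psi_char) mulrC -scalemxAl -rowE !mxE mulrN.
have cardP : #|P|%:R != 0 :> algC.
  by rewrite pnatr_eq0 -lt0n; apply/card_gt0P; exists 0; rewrite inE mxE.
have Uu : a *: delta_mx i 0 \in U by rewrite inE !mxE [j == i]eq_sym (negPf ij) mulr0.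
have -> : transl i j a = T (a *: delta_mx i 0).
  by rewrite /transl /T -scalemxAl mul_delta_mx.
apply: (mulfI cardP); rewrite !inversion componentT // mul0mx mxE.
by rewrite (addchar0 psi_char) mul1r.
Qed.

(** An [h] fixing [w] conjugates [T u] into [T (h u)], hence carries the component at [p *m val h]
    to the one at [p]. *)
Let active_move p p0 (h : slmx F n) :
  w *m val h = w -> p *m val h = p0 -> active p0 -> active p.
Proof.
move=> wh ph [g [x cx]]; exists (h * g)%g, (x * h^-1)%g.
suff <- : component p0 g x = component p (h * g)%g (x * h^-1)%g by [].
have Uh u : (val h *m u \in U) = (u \in U).
  have -> : (val h *m u \in U) = (w *m (val h *m u) == 0).
    by rewrite mul_w inE -scalemx1 scaler_eq0 oner_eq0 orbF.
  by rewrite mulmxA wh mul_w -scalemx1 scaler_eq0 oner_eq0 orbF.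
rewrite /component [RHS](reindex_inj (h := mulmx (val h))) /=; last first.
  by apply: can_inj (mulKmx (slmx_unit h)).
apply: eq_big => [u|u Uu]; first by rewrite [RHS]Uh.
rewrite mulmxA ph; congr (_ * v _); rewrite !mulgA; congr (_ * g)%g.
rewrite -!mulgA; congr (_ * _)%g; apply: (mulgI h); rewrite mulKVg.
apply: val_inj; rewrite !val_slmxM !val_T ?Uh //.
by rewrite mulmxDl mulmxDr mulmx1 mul1mx -!mulmxA wh.
Qed.

(** The shear [M] fixes [w] because [w *m y = 0], sends [p] to [p0] because [p *m y = 1], and has
    determinant 1 because [p] and [p0] agree on [y]. *)
Let active_shear p p0 (y : 'cV_n) :
  y \in U -> p *m y = 1%:M -> p0 *m y = 1%:M -> active p0 -> active p.
Proof.
move=> /eqP yj py p0y; pose M := 1%:M + y *m (p0 - p).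
have detM : \det M = 1.
  by rewrite det_1_add_col_row mulmxBl py p0y subrr mxE addr0.
apply: (@active_move _ _ (slmx_mk M)); rewrite slmx_mkK //.
  by rewrite mulmxDr mulmx1 mulmxA mul_w yj raddf0 mul0mx addr0.
by rewrite mulmxDr mulmx1 mulmxA py mul1mx addrC subrK.
Qed.

(** A [y] supported on [k] and [l] suffices: as [p' 0 k = 0], the system for its two entries is
    triangular. *)
Let shear_exists p p' k l : p \in P -> p' \in P ->
  p 0 k != 0 -> p' 0 k = 0 -> p' 0 l != 0 ->
  exists2 y, y \in U & p *m y = 1%:M /\ p' *m y = 1%:M.
Proof.
move=> /eqP pj /eqP p'j pk p'k p'l.
have kj : k != j by apply: contraNneq pk => ->; rewrite pj.
have lj : l != j by apply: contraNneq p'l => ->; rewrite p'j.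
pose b := (p' 0 l)^-1; pose a := (1 - p 0 l * b) / p 0 k.
exists (a *: delta_mx k 0 + b *: delta_mx l 0).
  by rewrite inE !mxE ![j == _]eq_sym (negPf kj) (negPf lj) !mulr0 addr0.
have mulE (r : 'rV[F]_n) :
    r *m (a *: delta_mx k 0 + b *: delta_mx l 0) = (a * r 0 k + b * r 0 l)%:M.
  rewrite mulmxDr -!scalemxAr -!colE [LHS]mx11_scalar; congr _%:M.
  by rewrite !mxE.
rewrite !mulE p'k mulr0 add0r /b mulVf //; split=> //; congr _%:M.
by rewrite /a mulfVK // [_ * p 0 l]mulrC subrK.
Qed.

Let active_all p p0 : p \in P -> p != 0 -> p0 \in P -> p0 != 0 -> active p0 -> active p.
Proof.
move=> Pp /rV0Pn[k pk] Pp0 /rV0Pn[l p0l] act0.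
have [p0k|p0k] := eqVneq (p0 0 k) 0.
  have [y Uy [py p0y]] := shear_exists Pp Pp0 pk p0k p0l.
  exact: active_shear Uy py p0y act0.
have kj : k != j by apply: contraNneq pk => ->; exact: Pp.
(* When [p0 0 k != 0], two shears through the basis row [q] are used; the size is at least 3, so
   there is an index [i] distinct from [j] and [k]. *)
have [i /andP[ij ik]] : exists i : 'I_n, (i != j) && (i != k).
  apply/existsP; apply: contraTT m_gt1; rewrite negb_exists => /forallP all_jk.
  have /subset_leq_card : [set: 'I_n] \subset [set j; k].
    by apply/subsetP => i _; move: (all_jk i); rewrite !inE negb_and !negbK.
  by rewrite cardsT card_ord cards2 eq_sym kj -leqNgt.
pose q : 'rV[F]_n := delta_mx 0 i.
have Pq : q \in P by rewrite inE mxE [j == i]eq_sym (negPf ij) andbF.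
have qk : q 0 k = 0 by rewrite mxE [k == i]eq_sym (negPf ik) andbF.
have qi : q 0 i != 0 by rewrite mxE !eqxx oner_eq0.
have [y Uy [py qy]] := shear_exists Pp Pq pk qk qi.
have [y' Uy' [p0y' qy']] := shear_exists Pp0 Pq p0k qk qi.
exact: active_shear Uy py qy (active_shear Uy' qy' p0y' act0).
Qed.

Let cardP : (#|F| ^ m <= #|P|)%N.
Proof.
have -> : (#|F| ^ m)%N = #|{: 'rV[F]_m}| by rewrite card_mx mul1n.
pose f (r : 'rV[F]_m) : 'rV[F]_n := \row_k (if unlift j k is Some k' then r 0 k' else 0).
have f_inj : injective f.
  move=> r r' /rowP frr'; apply/rowP => k; have := frr' (lift j k).
  by rewrite !mxE liftK.
rewrite -(card_codom f_inj) subset_leq_card //.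
by apply/subsetP => _ /codomP[r ->]; rewrite inE mxE unlift_none.
Qed.

(** One translate component is taken for each nonzero [p] in [P]; components for distinct characters
    are orthogonal. *)
Lemma orthogonal_translates i a x : i != j -> v (x * transl i j a)%g != v x ->
  exists (I : finType) (f : I -> slmx F n -> algC),
    [/\ (#|F| ^ m - 1 <= #|I|)%N,
        forall i, exists c : slmx F n -> algC,
          forall x, f i x = \sum_g c g * v (x * g)%g,
        forall i, exists x, f i x != 0 &
        forall i j, i != j -> \sum_x f i x * (f j x)^* = 0].
Proof.
move=> ij vx; have [p0 Pp0 [p0_neq0 act0]] := active_exists ij vx.
pose I := {p : 'rV[F]_n | (p \in P) && (p != 0)}.
have act (p : I) : exists g, exists x, component (val p) g x != 0.
  by have /andP[Pp p_neq0] := valP p; apply: active_all Pp p_neq0 Pp0 p0_neq0 act0.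
have [g gP] := fin_all_exists act.
exists I, (fun p => component (val p) (g p)); split=> //.
- rewrite card_sig leq_subLR (leq_trans cardP) // (cardD1 0) inE mxE eqxx leq_add2l.
  by rewrite subset_leq_card //; apply/subsetP => p; rewrite !inE andbC.
- move=> p; exists (fun h => \sum_(u in U | (T u * g p)%g == h) psi (- (val p *m u) 0 0)).
  move=> y; rewrite /component (partition_big (fun u => (T u * g p)%g) predT) //=.
  apply: eq_bigr => h _; rewrite mulr_suml; apply: eq_bigr => u /andP[_ /eqP <-].
  by rewrite mulgA.
- move=> p p' pp'.
  have /rV0Pn[k dk] : val p - val p' != 0 by rewrite subr_eq0 (inj_eq val_inj).
  have /andP[/eqP pj _] := valP p; have /andP[/eqP p'j _] := valP p'.
  have [b psib] := addchar_scale_neq1 psi_char dk.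
  have kj : k != j by apply: contraNneq dk => ->; rewrite !mxE pj p'j subrr.
  pose u : 'cV[F]_n := b *: delta_mx k 0.
  have Uu : u \in U by rewrite inE !mxE [j == k]eq_sym (negPf kj) mulr0.
  have mulu (r : 'rV[F]_n) : (r *m u) 0 0 = b * r 0 k.
    by rewrite /u -scalemxAr -colE !mxE.
  (* Right translation by [T u] preserves [S] and multiplies it by the value at [u] of the quotient
     of the two characters, which differs from 1. *)
  set S := \sum_x _; have : S = psi (b * (val p - val p') 0 k) * S.
    rewrite {1}/S (reindex_inj (mulIg (T u))) mulr_sumr; apply: eq_bigr => y _ /=.
    rewrite !componentT // rmorphM /= -(addcharN psi_char) mulrACA.
    by rewrite -(addcharD psi_char) !mulu !mxE mulrBr.
  move/eqP; rewrite -subr_eq0 -{1}[S]mul1r -mulrBl mulf_eq0 subr_eq0 eq_sym.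
  by rewrite (negPf psib) => /eqP.
Qed.

End SLQuasirandom.

Lemma SL_quasirandom (F : finFieldType) (m : nat) : (2 <= m)%N ->
  quasirandom (slmx F m.+1) (#|F| ^ m - 1).
Proof.
move=> m_gt1 v v_neq0 v_mean0.
have [psi psi_char] := nontrivial_addchar_exists F.
have [i [j [a [x [ij vx]]]]] := transvection_moves v_neq0 v_mean0.
by have := orthogonal_translates psi_char m_gt1 ij vx.
Qed.

(** * Exponential sums over matrices of fixed determinant *)

Section DeterminantExponentialSum.

Variables (F : finFieldType) (psi : F -> algC).
Hypothesis psi_char : nontrivial_addchar psi.
Local Notation q := #|F|.

(** The exponential sum over a determinant fibre, with the frequency matrix in rank normal form;
    [det1_expsum_bound] reduces the general frequency to it. *)
Let kappa n r (d : F) := \sum_(g : 'M[F]_n | \det g == d) psi (\tr (pid_mx r *m g)).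

Let pid_mxS m r : pid_mx (1 + r) = block_mx 1%:M 0 0 (pid_mx r) :> 'M[F]_(1 + m).
Proof.
apply/matrixP => i j; rewrite !mxE; case: splitP => i' ->; rewrite !mxE;
  by case: splitP => j' ->; rewrite !mxE ?ord1.
Qed.

(* Averaging over the right translations by [block_mx 1%:M 0 w 1%:M] kills all
   [g] whose upper right block is non-zero. *)
Let kappaS m r d : d != 0 -> kappa (1 + m) (1 + r) d =
  (q ^ m)%:R * \sum_(h : 'M[F]_m | \det h != 0) psi (d / \det h + \tr (pid_mx r *m h)).
Proof.
move=> d0; pose L (w : 'cV[F]_m) : 'M[F]_(1 + m) := block_mx 1%:M 0 w 1%:M.
have detL w : \det (L w) = 1 by rewrite det_lblock !det1 mulr1.
have trE (x : 'M[F]_1) (y : 'rV[F]_m) (z : 'cV_m) (h : 'M_m) :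
    \tr (pid_mx (1 + r) *m block_mx x y z h) = x 0 0 + \tr (pid_mx r *m h).
  rewrite pid_mxS mulmx_block !mul1mx !mul0mx !addr0 !add0r mxtrace_block.
  by congr (_ + _); rewrite /mxtrace big_ord1.
have kappa_w (w : 'cV[F]_m) : kappa (1 + m) (1 + r) d =
    \sum_(g : 'M[F]_(1 + m) | \det g == d)
      psi (\tr (pid_mx (1 + r) *m g)) * psi ((ursubmx g *m w) 0 0).
  rewrite /kappa (reindex_inj (h := fun g => g *m L w)) /=; last first.
    by apply: can_inj (mulmxK _); rewrite unitmxE detL unitr1.
  apply: eq_big => [g|g _]; first by rewrite det_mulmx detL mulr1.
  rewrite -(addcharD psi_char); congr psi; rewrite -{1 2}[g]submxK.
  rewrite mulmx_block !mulmx1 !mulmx0 !add0r !trE mxE.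
  by rewrite addrAC.
have qm_neq0 : (q ^ m)%:R != 0 :> algC.
  by rewrite pnatr_eq0 -lt0n expn_gt0 (ltnW (card_finNzRing_gt1 F)).
have -> : kappa (1 + m) (1 + r) d =
    \sum_(g : 'M[F]_(1 + m) | (\det g == d) && (ursubmx g == 0))
      psi (\tr (pid_mx (1 + r) *m g)).
  apply: (mulfI qm_neq0).
  transitivity (\sum_(w : 'cV[F]_m) kappa (1 + m) (1 + r) d).
    by rewrite sumr_const -[RHS]mulr_natl card_mx muln1.
  under eq_bigr => w _ do rewrite (kappa_w w).
  rewrite exchange_big mulr_sumr [RHS]big_mkcondr; apply: eq_bigr => g _ /=.
  rewrite -mulr_sumr (sum_addchar_mul psi_char).
  by case: eqP => _; rewrite ?mul1r ?mul0r ?mulr0 // mulrC.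
pose mk (zh : 'cV[F]_m * 'M[F]_m) : 'M[F]_(1 + m) :=
  block_mx (d / \det zh.2)%:M 0 zh.1 zh.2.
rewrite (reindex_onto mk (fun g => (dlsubmx g, drsubmx g))) /=; last first.
  move=> g /andP[/eqP detg /eqP ur0]; rewrite /mk /= -[RHS]submxK ur0.
  move: detg; rewrite -[g in \det g]submxK ur0 det_lblock => detg.
  have dr0 : \det (drsubmx g) != 0.
    by apply: contraNneq d0 => dr0; rewrite -detg dr0 mulr0.
  congr (block_mx _ _ _ _); rewrite [RHS]mx11_scalar; congr _%:M.
  by rewrite -detg mulfK // [in LHS](mx11_scalar (ulsubmx g)) det_scalar1.
transitivity (\sum_(zh : 'cV[F]_m * 'M[F]_m | true && (\det zh.2 != 0))
    psi (d / \det zh.2 + \tr (pid_mx r *m zh.2))).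
  apply: eq_big => [[z h]|[z h] _]; rewrite /mk /=; last by rewrite trE mxE eqxx.
  rewrite block_mxKdl block_mxKdr block_mxKur !eqxx !andbT det_lblock det_scalar1.
  have [->|h0] := eqVneq (\det h) 0; first by rewrite mulr0 eq_sym (negPf d0).
  by rewrite divfK ?eqxx.
rewrite -(pair_big xpredT (fun h : 'M_m => \det h != 0)
  (fun _ h => psi (d / \det h + \tr (pid_mx r *m h)))) /=.
by rewrite sumr_const -[LHS]mulr_natl card_mx muln1.
Qed.

(** With [kappaS] this is a recursion lowering both the size and the rank by one. *)
Let sum_by_det m r d : \sum_(h : 'M[F]_m | \det h != 0)
    psi (d / \det h + \tr (pid_mx r *m h)) = \sum_(e | e != 0) psi (d / e) * kappa m r e.
Proof.
rewrite (partition_big (fun h : 'M_m => \det h) (fun e => e != 0)) //=.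
apply: eq_bigr => e e0; rewrite mulr_sumr; apply: eq_big => [h|h /andP[_ /eqP ->]].
  by have [->|] := eqVneq (\det h) e; rewrite ?e0 ?andbF.
by rewrite (addcharD psi_char).
Qed.

Let norm_sum_psi (T : finType) (A : pred T) (f : T -> F) :
  `|\sum_(x | A x) psi (f x)| <= #|A|%:R.
Proof.
rewrite (le_trans (ler_norm_sum _ _ _)) //.
by under eq_bigr do rewrite (addchar_norm psi_char); rewrite sumr_const.
Qed.

Let kappa_trivial_bound m r d : d != 0 -> `|kappa (1 + m) (1 + r) d| <= (q ^ (m + m ^ 2))%:R.
Proof.
move=> d0; rewrite kappaS // normrM normr_nat expnD natrM ler_wpM2l ?ler0n //.
rewrite (le_trans (norm_sum_psi _ _)) // ler_nat -(card_mx F m m).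
exact: max_card.
Qed.

(** Scaling the first row by [d], or by its inverse, maps one fibre injectively into the other. *)
Lemma card_det_fibre m (d : F) : d != 0 ->
  #|[set g : 'M[F]_m.+1 | \det g == d]| = #|SL m.+1 F|.
Proof.
move=> d0; pose f (c : F) (g : 'M[F]_m.+1) := (1%:M + (c - 1) *: delta_mx 0 0) *m g.
have detf (c : F) g : \det (f c g) = c * \det g.
  rewrite det_mulmx -(mul_delta_mx (0 : 'I_1)) scalemxAl det_1_add_col_row.
  by rewrite -scalemxAr mul_delta_mx !mxE !eqxx mulr1 addrC subrK.
have finj (c : F) : c != 0 -> injective (f c).
  move=> c0; apply: can_inj (mulKmx _).
  by rewrite unitmxE -[X in \det X]mulmx1 detf det1 mulr1 unitfE.
apply/eqP; rewrite eqn_leq; apply/andP; split.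
  rewrite -(card_imset _ (finj d^-1 _)) ?invr_eq0 //.
  apply/subset_leq_card/subsetP => _ /imsetP[g gd ->].
  by move: gd; rewrite !inE detf => /eqP ->; rewrite mulVf.
rewrite -(card_imset (mem (SL m.+1 F)) (finj d d0)).
apply/subset_leq_card/subsetP => _ /imsetP[g g1 ->].
by move: g1; rewrite !inE detf => /eqP ->; rewrite mulr1.
Qed.

Lemma card_SL_unitmx m :
  (q.-1 * #|SL m.+1 F|)%N = #|[pred g : 'M[F]_m.+1 | g \in unitmx]|.
Proof.
rewrite -[RHS]sum1_card (partition_big (fun h : 'M_m.+1 => \det h) (fun e : F => e != 0)) /=.
  transitivity (\sum_(e : F | e != 0%R) #|SL m.+1 F|)%N.
    by rewrite sum_nat_const cardC1.
  apply: eq_bigr => e e0; rewrite -(card_det_fibre m e0) -sum1_card; apply: eq_bigl => h.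
  by rewrite !inE unitmxE unitfE; have [->|] := eqVneq (\det h) e; rewrite ?e0 ?andbF.
by move=> h; rewrite inE unitmxE unitfE.
Qed.

Lemma card_SL_upper m : (q.-1 * #|SL m.+1 F| <= q ^ (m.+1 ^ 2))%N.
Proof.
rewrite card_SL_unitmx -[(m.+1 ^ 2)%N]/(m.+1 * m.+1)%N -(card_mx F).
exact: max_card.
Qed.

(** In the product formula for the order of GL, each factor satisfies [q ^ i <= 2 * (q ^ i - 1)]. *)
Lemma card_SL_lower m : (q ^ (m.+1 ^ 2) <= 2 ^ m.+1 * (q.-1 * #|SL m.+1 F|))%N.
Proof.
have q_gt1 := card_finNzRing_gt1 F.
have -> : (q.-1 * #|SL m.+1 F|)%N = #|'GL_(m.+1)[F]%g|.
  by rewrite card_SL_unitmx cardsT card_sub; apply: eq_card => g; rewrite !inE.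
rewrite card_GL // mulnCA.
have -> : (2 ^ m.+1 * \prod_(1 <= i < m.+2) (q ^ i - 1) =
    \prod_(1 <= i < m.+2) (2 * (q ^ i - 1)))%N.
  by rewrite big_split /= prod_nat_const_nat subSS subn0.
have -> : (q ^ (m.+1 ^ 2) = q ^ 'C(m.+1, 2) * \prod_(1 <= i < m.+2) q ^ i)%N.
  rewrite -expn_sum -expnD; congr (_ ^ _)%N.
  have := bin2_sum m.+2; rewrite big_ltn // add0n => ->.
  elim: (m.+1) => // k IHk; rewrite !binS !bin1 bin0 -!mulnn in IHk *; lia.
rewrite leq_mul2l; apply/orP; right; rewrite big_nat [leqRHS]big_nat.
apply: leq_prod => i /andP[i_gt0 _].
have : (1 < q ^ i)%N by rewrite -(exp1n i) ltn_exp2r.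
by move: (q ^ i)%N => k; lia.
Qed.

(** Gains a factor of order [q] over [kappa_trivial_bound] by running the recursion once more. When
    the remaining rank is 0, the inner [kappa] does not depend on [e] and the sum of [psi (d / e)]
    over [e != 0] is -1; otherwise the trivial bound is applied to each inner sum. *)
Let kappa_bound m r d : (2 <= m)%N -> d != 0 ->
  q%:R * `|kappa (1 + m) (1 + r) d| <= 2%:R * (q ^ (m + m ^ 2))%:R.
Proof.
case: m => // m m_gt0 d0; have q_gt1 := card_finNzRing_gt1 F.
rewrite kappaS // sum_by_det normrM normr_nat [in leRHS]expnD natrM.
rewrite mulrCA [leRHS]mulrCA ler_wpM2l ?ler0n //.
case: r => [|r].
  have kappa0 e : e != 0 -> kappa m.+1 0 e = #|SL m.+1 F|%:R.
    move=> e0; rewrite -(card_det_fibre m e0) /kappa -sum1_card natr_sum.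
    apply: eq_big => [g|g _]; first by rewrite inE.
    by rewrite pid_mx_0 mul0mx mxtrace0 (addchar0 psi_char).
  under eq_bigr => e e0 do rewrite kappa0 //.
  have -> : \sum_(e : F | e != 0) psi (d / e) * #|SL m.+1 F|%:R = - #|SL m.+1 F|%:R.
    rewrite -mulr_suml -mulN1r; congr (_ * _).
    rewrite (reindex_onto (fun e => d / e) (fun e => d / e)) /=; last first.
      by move=> e e0; rewrite invf_div mulrCA divff ?mulr1.
    have sum0 : \sum_(e : F) psi e = 0.
      case: psi_char => _ _ [a psia].
      apply: (sum_shift_eq0 (A := xpredT) (t := a) _ _ psia) => // x.
      by rewrite (addcharD psi_char) mulrC.
    move: sum0; rewrite (bigD1 0) //= (addchar0 psi_char) addrC => /eqP.
    rewrite addr_eq0 => /eqP <-.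
    apply: eq_big => [e|e /andP[_ /eqP e_id]]; last by rewrite e_id.
    have [->|e0] := eqVneq e 0; first by rewrite invr0 mulr0 eqxx.
    by rewrite mulf_neq0 ?invr_neq0 //= invf_div mulrCA divff // mulr1 eqxx.
  rewrite normrN normr_nat -!natrM ler_nat.
  apply: leq_trans (_ : 2 * (q.-1 * #|SL m.+1 F|) <= _)%N; last first.
    by rewrite leq_pmul2l // card_SL_upper.
  by rewrite mulnA leq_mul2r; apply/orP; right; case: q q_gt1 => [|[|k]] //=; lia.
(* The exponents satisfy [2 + m + m ^ 2 <= m.+1 ^ 2] since [m >= 1], that is, for matrices of size
   at least 3. *)
apply: (@le_trans _ _ (q%:R * (q%:R * (q ^ (m + m ^ 2))%:R))).
  rewrite ler_wpM2l ?ler0n // (le_trans (ler_norm_sum _ _ _)) //.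
  apply: (@le_trans _ _ (\sum_(e : F | e != 0) (q ^ (m + m ^ 2))%:R)).
    apply: ler_sum => e e0; rewrite normrM (addchar_norm psi_char) mul1r.
    exact: kappa_trivial_bound.
  rewrite sumr_const -[leLHS]mulr_natl ler_wpM2r ?ler0n // ler_nat.
  exact: max_card.
rewrite -!natrM ler_nat -!expnS; apply: leq_trans (leq_pmull _ _) => //.
by rewrite leq_exp2l //; lia.
Qed.

(** With [M = L *m pid_mx r *m U], replacing [g] by [U *m g *m L] puts the frequency in normal form
    and changes the determinant from 1 to [d]. *)
Lemma det1_expsum_bound m (M : 'M[F]_m.+1) : (2 <= m)%N -> M != 0 ->
  q%:R * `|\sum_(g in SL m.+1 F) psi (\tr (M *m g))| <= 2%:R * (q ^ (m + m ^ 2))%:R.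
Proof.
move=> m_gt1 M0; pose L := col_ebase M; pose U := row_ebase M.
have [r rankM] : exists r, \rank M = r.+1.
  by exists (\rank M).-1; rewrite prednK // lt0n mxrank_eq0.
pose d := \det U * \det L.
have d0 : d != 0.
  by rewrite mulf_neq0 // -unitfE -unitmxE ?row_ebase_unit ?col_ebase_unit.
have -> : \sum_(g in SL m.+1 F) psi (\tr (M *m g)) = kappa m.+1 r.+1 d.
  rewrite /kappa [RHS](reindex_inj (h := fun g => U *m g *m L)) /=; last first.
    move=> g h /(can_inj (mulmxK (col_ebase_unit M))).
    exact: (can_inj (mulKmx (row_ebase_unit M))).
  apply: eq_big => [g|g _].
    rewrite !det_mulmx inE mulrAC -/d -[RHS](inj_eq (mulfI (invr_neq0 d0))).
    by rewrite mulKf // mulVf.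
  congr psi; rewrite -{1}(mulmx_ebase M) rankM -/L -/U.
  by rewrite -!mulmxA mxtrace_mulC -!mulmxA.
exact: kappa_bound.
Qed.

End DeterminantExponentialSum.

(** * Expansion of the special linear group in the matrix ring *)

Section UnimodularCayleyGraph.

Variables (F : finFieldType) (m : nat).
Hypothesis m_gt1 : (2 <= m)%N.
Local Notation n := m.+1.
Local Notation q := #|F|.
Local Notation N := (q ^ (n ^ 2))%N.

Lemma fourier_parseval (psi : F -> algC) (A : {set 'M[F]_n}) : nontrivial_addchar psi ->
  \sum_(M : 'M[F]_n) `|\sum_(a in A) psi (\tr (M *m a))| ^+ 2 = N%:R * #|A|%:R.
Proof.
move=> psi_char.
under eq_bigr => M _ do rewrite normCK rmorph_sum mulr_suml.
rewrite exchange_big mulr_natr -sumr_const; apply: eq_bigr => a Aa /=.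
under eq_bigr => M _ do rewrite mulr_sumr.
rewrite exchange_big (bigD1 a) //= [X in _ + X]big1 ?addr0 => [|b /andP[_ ba]];
  under eq_bigr => M _ do
    rewrite -(addcharN psi_char) -(addcharD psi_char) -linearB -mulmxBr.
  by rewrite (sum_addchar_trace psi_char) subrr eqxx mul1r.
by rewrite (sum_addchar_trace psi_char) subr_eq0 eq_sym (negPf ba) mul0r.
Qed.

(** The pairs [(a, a + x)] are edges between [A] and [S]. Either the zero frequency, of size
    [#|SL n F| * #|A| * #|S|], accounts for at least half of the resulting lower bound for the edge
    count, or the nonzero frequencies do; these are bounded by Cauchy-Schwarz and Parseval. *)
Lemma SL_mixing (A S X : {set 'M[F]_n}) :
  X \subset SL n F -> (forall a x, a \in A -> x \in X -> a + x \in S) ->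
  (N * #|X| <= 2 * #|SL n F| * #|S|)%N ||
  (q ^ 2 * (#|A| * #|X| ^ 2) <= 16 * (q ^ (m + m ^ 2)) ^ 2 * #|S|)%N.
Proof.
move=> XSL AXS; have [//|] := leqP (N * #|X|) (2 * #|SL n F| * #|S|); rewrite /=.
set Q := (q ^ (m + m ^ 2))%N; set G := #|SL n F| => NX.
have [->|A_gt0] := posnP #|A|; first by rewrite mul0n muln0.
have [psi psi_char] := nontrivial_addchar_exists F.
pose hat (B : {set 'M[F]_n}) M := \sum_(b in B) psi (\tr (M *m b)).
pose edges := #|[set p in setX A S | p.2 - p.1 \in SL n F]|.
have edges_ge : (#|A| * #|X| <= edges)%N.
  rewrite -cardsX -(card_in_imset (f := fun p => (p.1, p.1 + p.2))); last first.
    by move=> [a x] [b y] _ _ [<-] /addrI ->.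
  apply/subset_leq_card/subsetP => _ /imsetP[[a x] /setXP[Aa Xx] ->].
  rewrite !inE Aa AXS //= addrC addKr.
  by have := subsetP XSL _ Xx; rewrite inE.
have edgesE : N%:R * edges%:R = \sum_M hat (SL n F) M * (hat A M * (hat S M)^*).
  have indicator (a s : 'M[F]_n) : N%:R * (s - a \in SL n F)%:R =
      \sum_M hat (SL n F) M * (psi (\tr (M *m a)) * (psi (\tr (M *m s)))^*) :> algC.
    under eq_bigr => M _ do rewrite mulr_suml.
    rewrite exchange_big /=.
    transitivity (\sum_(g in SL n F) ((g == s - a)%:R * N%:R : algC)).
      have [sa|sa] := boolP (s - a \in SL n F); last first.
        rewrite mulr0 big1 // => g gSL; have [gE|] := eqVneq; last by rewrite mul0r.
        by rewrite -gE gSL in sa.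
      rewrite (bigD1 (s - a)) //= eqxx mulr1 mul1r big1 ?addr0 // => g /andP[_ /negPf ->].
      by rewrite mul0r.
    apply: eq_bigr => g _.
    under eq_bigr => M _ do
      rewrite -(addcharN psi_char) -!(addcharD psi_char) -linearB -linearD -mulmxBr -mulmxDr.
    by rewrite (sum_addchar_trace psi_char) -[g == _]subr_eq0 opprB.
  have -> : edges%:R = \sum_(a in A) \sum_(s in S) (s - a \in SL n F)%:R :> algC.
    rewrite pair_big /= /edges -sum1_card natr_sum [RHS]big_mkcond [LHS]big_mkcond.
    apply: eq_bigr => -[a s] _; rewrite !inE /=.
    by case: (a \in A); case: (s \in S); case: (_ == 1).
  rewrite mulr_sumr; under eq_bigr => a _ do rewrite mulr_sumr.
  under eq_bigr => a _ do under eq_bigr => s _ do rewrite indicator.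
  under eq_bigr => a _ do rewrite exchange_big.
  rewrite exchange_big; apply: eq_bigr => M _ /=.
  under eq_bigr => a _ do rewrite -mulr_sumr -mulr_sumr.
  by rewrite -mulr_sumr -mulr_suml rmorph_sum.
have hat0 B : hat B 0 = #|B|%:R.
  rewrite /hat; under eq_bigr do rewrite mul0mx mxtrace0 (addchar0 psi_char).
  by rewrite sumr_const.
have main : q%:R * (N%:R * edges%:R - G%:R * (#|A|%:R * #|S|%:R)) <=
    2%:R * Q%:R * \sum_M `|hat A M| * `|hat S M|.
  rewrite edgesE (bigD1 0) //= !hat0 conjC_nat -/G addrAC subrr add0r.
  (* In [algC] a number is bounded by its norm only when it is real; here it is a difference of
     natural-number expressions. *)
  have err_real : \sum_(M | M != 0) hat (SL n F) M * (hat A M * (hat S M)^*) \is Num.real.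
    have := edgesE; rewrite (bigD1 0) //= !hat0 conjC_nat => /eqP.
    rewrite addrC -subr_eq => /eqP <-.
    by rewrite rpredB // !rpredM // realn.
  apply: le_trans (ler_wpM2l (ler0n _ q) (real_ler_norm err_real)) _.
  rewrite (le_trans (ler_wpM2l (ler0n _ q) (ler_norm_sum _ _ _))) //.
  rewrite mulr_sumr mulr_sumr [leRHS](bigD1 0) //=.
  rewrite ler_wpDl ?mulr_ge0 ?ler0n //; apply: ler_sum => M M0.
  rewrite !normrM norm_conjC mulrA ler_wpM2r ?mulr_ge0 //.
  exact: det1_expsum_bound.
have CS := CauchySchwarz_norm xpredT (hat A) (hat S).
rewrite !fourier_parseval // in CS.
have half : N%:R * (#|A|%:R * #|X|%:R) <=
    2%:R * (N%:R * edges%:R - G%:R * (#|A|%:R * #|S|%:R)) :> algC.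
  rewrite mulrBr lerBrDr -!natrM -natrD ler_nat.
  have := leq_mul (leqnn #|A|) (ltnW NX); have := leq_mul (leqnn N) edges_ge.
  by clear; move: #|A| #|X| #|S| edges G N => a x s e g k; lia.
have N_gt0 : (0 < N)%N by rewrite expn_gt0 (ltnW (card_finNzRing_gt1 F)).
(* The 4 combines the factor 2 of [half] with the 2 of [det1_expsum_bound]; squaring gives the 16 of
   the statement. *)
have bound : (q%:R * (N%:R * (#|A|%:R * #|X|%:R))) ^+ 2 <=
    (4%:R * Q%:R) ^+ 2 * (N%:R * #|A|%:R * (N%:R * #|S|%:R)) :> algC.
  apply: le_trans (_ : (4%:R * Q%:R * \sum_M `|hat A M| * `|hat S M|) ^+ 2 <= _).
    rewrite lerXn2r ?nnegrE -?natrM ?ler0n //.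
      by rewrite mulr_ge0 ?ler0n ?sumr_ge0 // => M _; rewrite mulr_ge0.
    rewrite !natrM; apply: le_trans (ler_wpM2l (ler0n _ q) half) _.
    rewrite mulrCA (_ : 4%:R * Q%:R = 2%:R * (2%:R * Q%:R)); last by ring.
    by rewrite -[leRHS]mulrA ler_wpM2l ?ler0n.
  by rewrite exprMn ler_wpM2l // exprn_ge0 // -natrM ler0n.
rewrite -!natrM -!natrX -!natrM ler_nat in bound.
rewrite -(leq_pmul2l N_gt0) -(leq_pmul2l N_gt0) -(leq_pmul2l A_gt0).
apply: leq_trans (leq_trans bound _); first by rewrite leq_eqVlt; apply/orP; left; apply/eqP; ring.
by rewrite leq_eqVlt; apply/orP; left; apply/eqP; ring.
Qed.

End UnimodularCayleyGraph.

(** * Product sets in the special linear group *)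

Section SLBounds.

Variables (F : finFieldType) (m : nat).
Local Notation n := m.+1.
Local Notation q := #|F|.

(** The exponent is [n ^ 2 - 1] written without subtraction, and [q <= 2 * q.-1] accounts for the
    2. *)
Lemma card_SL_le : (#|SL n F| <= 2 * q ^ (m ^ 2 + 2 * m))%N.
Proof.
have := card_SL_upper F m; have := card_finNzRing_gt1 F.
have -> : (m.+1 ^ 2 = (m ^ 2 + 2 * m).+1)%N by rewrite -!mulnn; lia.
by rewrite expnS; case: q => // k; move: #|SL n F| (_ ^ _)%N => g e /=; nia.
Qed.

Lemma card_SL_ge : (q ^ (m ^ 2 + 2 * m) <= 2 ^ n * #|SL n F|)%N.
Proof.
have := card_SL_lower F m; have := card_finNzRing_gt1 F.
have -> : (m.+1 ^ 2 = (m ^ 2 + 2 * m).+1)%N by rewrite -!mulnn; lia.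
by rewrite expnS; case: q => // k; move: #|SL n F| (_ ^ (_ + _))%N (2 ^ n)%N => g e t /=; nia.
Qed.

(** Transfers [quasirandom_mulset] from the group type [slmx F n] to sets of matrices. *)
Lemma SL_mulset (B C : {set 'M[F]_n}) : (2 <= m)%N ->
  B \subset SL n F -> C \subset SL n F ->
  exists X : {set 'M[F]_n},
    [/\ X \subset SL n F,
        forall x, x \in X -> exists2 b, b \in B & exists2 c, c \in C & x = b *m c &
        ((q ^ m - 1) * #|SL n F| * (#|B| * #|C|) <=
         #|X| * ((q ^ m - 1) * (#|B| * #|C|) + #|SL n F| ^ 2))%N].
Proof.
move=> m_gt1 BSL CSL.
have cardSL : #|{: slmx F n}| = #|SL n F|.
  by rewrite card_sig; apply: eq_card => g; rewrite !inE.
pose lift (D : {set 'M[F]_n}) : {set slmx F n} := [set g | val g \in D].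
have card_lift (D : {set 'M[F]_n}) : D \subset SL n F -> #|lift D| = #|D|.
  move=> DSL; rewrite -(card_imset _ (val_inj : injective (val : slmx F n -> 'M[F]_n))).
  apply: eq_card => g; apply/imsetP/idP => [[h] | Dg]; first by rewrite inE => Dh ->.
  have /eqP detg : \det g == 1 by have := subsetP DSL _ Dg; rewrite inE.
  by exists (slmx_mk g); rewrite ?inE slmx_mkK.
exists [set val g | g in (lift B * lift C)%g]; split.
- by apply/subsetP => _ /imsetP[g _ ->]; rewrite inE (valP g).
- move=> _ /imsetP[_ /mulsgP[b c Bb Cc ->] ->]; exists (val b); first by rewrite inE in Bb.
  by exists (val c); rewrite ?val_slmxM //; rewrite inE in Cc.
- rewrite card_imset; last exact: val_inj.
  have := quasirandom_mulset (lift B) (lift C) (@SL_quasirandom F m m_gt1).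
  by rewrite !card_lift // cardSL.
Qed.

Lemma SL_mulset_growth (B C : {set 'M[F]_n}) : (2 <= m)%N ->
  B \subset SL n F -> C \subset SL n F ->
  exists X : {set 'M[F]_n},
    [/\ X \subset SL n F,
        forall x, x \in X -> exists2 b, b \in B & exists2 c, c \in C & x = b *m c &
        (q ^ (m ^ 2 + 2 * m) <= 2 ^ n.+1 * #|X|)%N ||
        (q ^ m * (#|B| * #|C|) <= 8 * (#|X| * q ^ (m ^ 2 + 2 * m)))%N].
Proof.
move=> m_gt1 BSL CSL; have [X [XSL XBC]] := SL_mulset m_gt1 BSL CSL.
have um_gt1 : (1 < q ^ m)%N.
  by rewrite -(exp1n m) ltn_exp2r ?card_finNzRing_gt1 // (ltnW m_gt1).
have G_le := card_SL_le; have G_ge := card_SL_ge.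
set G := #|SL n F| in G_le G_ge *; set P := (#|B| * #|C|)%N.
set u := (q ^ m)%N in um_gt1 *; set E := (q ^ _)%N in G_le G_ge *.
move=> growth; exists X; split=> //; apply/orP.
have G_gt0 : (0 < G)%N.
  by apply/card_gt0P; exists 1%:M; rewrite inE det1.
(* The sum in [growth] is at most twice its larger term. In the first case the 8 collects this 2,
   the 2 of [card_SL_le] and the 2 from [u <= 2 * (u - 1)]. *)
have [DPG|/ltnW DPG] := leqP ((u - 1) * P) (G ^ 2).
  right; have : ((u - 1) * P <= 2 * (#|X| * G))%N.
    rewrite -(leq_pmul2r G_gt0) mulnAC (leq_trans growth) //.
    have : (#|X| * ((u - 1) * P + G ^ 2) <= #|X| * (G ^ 2 + G ^ 2))%N.
      by rewrite leq_mul2l leq_add2r DPG orbT.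
    by move/leq_trans; apply; rewrite -mulnn; lia.
  have : (#|X| * G <= #|X| * (2 * E))%N by rewrite leq_mul2l G_le orbT.
  have : (u * P <= 2 * ((u - 1) * P))%N by rewrite mulnA leq_mul2r; apply/orP; right; lia.
  lia.
left; have P_gt0 : (0 < (u - 1) * P)%N.
  by rewrite (leq_trans _ DPG) // expn_gt0 G_gt0.
have : (G <= 2 * #|X|)%N.
  rewrite -(leq_pmul2l P_gt0) (leq_trans _ (leq_trans growth _)) //.
    by rewrite mulnAC.
  have : (#|X| * ((u - 1) * P + G ^ 2) <= #|X| * ((u - 1) * P + (u - 1) * P))%N.
    by rewrite leq_mul2l leq_add2l DPG orbT.
  by move/leq_trans; apply; lia.
move=> GX; rewrite (leq_trans G_ge) // [(2 ^ n.+1)%N]expnSr -mulnA.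
by rewrite leq_mul2l GX orbT.
Qed.

End SLBounds.

(** * Combination of the two growth alternatives *)

Theorem theorem1p3 (R : realType) (n : nat) (hn : (3 <= n)%N) :
  exists2 c : R, 0 < c &
    forall (q : nat) (F : finFieldType), #|F| = q -> odd q ->
    forall A B C : {set 'M[F]_n}, B \subset SL n F -> C \subset SL n F ->
      c * Num.min (q%:R ^+ (n ^ 2)%N)
           (Num.min (q%:R ^+ (2 * n)%N * #|A|%:R)
           (Num.min (#|A|%:R * #|B|%:R ^+ 2 * #|C|%:R ^+ 2
                       / q%:R ^+ (4 * n ^ 2 - 4 * n - 2)%N)
                    (#|B|%:R * #|C|%:R / q%:R ^+ (n ^ 2 - n - 1)%N)))
      <= #|fimage A B C|%:R.
Proof.
case: n hn => // m; rewrite ltnS => m_gt1.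
(* [alpha] absorbs both constants of [SL_mulset_growth], [2 ^ m.+2] and 8. It enters squared below
   since the second alternative of [SL_mixing] is quadratic in [#|X|]; the 16 comes from there
   too. *)
pose alpha : R := (2 ^+ m.+4)^-1.
have alpha_gt0 : 0 < alpha by rewrite invr_gt0 exprn_gt0.
have alpha_le1 : alpha <= 1 by rewrite invf_le1 ?exprn_gt0 // exprn_ege1 // ler1n.
exists (alpha ^+ 2 / 16%:R); first by rewrite divr_gt0 ?exprn_gt0 ?ltr0n.
move=> q F cardF _ A B C BSL CSL.
have q_gt1 : (1 < q)%N by rewrite -cardF card_finNzRing_gt1.
have [X [XSL XBC growth]] := SL_mulset_growth m_gt1 BSL CSL.
have AX a x : a \in A -> x \in X -> a + x \in fimage A B C.
  move=> Aa /XBC[b Bb [c Cc ->]]; rewrite inE; apply/existsP; exists a.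
  rewrite Aa; apply/existsP; exists b; rewrite Bb; apply/existsP; exists c.
  by rewrite Cc /=.
have mixing := SL_mixing m_gt1 XSL AX.
have SL_le := card_SL_le F m.
rewrite {}cardF in growth mixing SL_le *.
set s := #|fimage A B C| in mixing *; set G := #|SL m.+1 F| in mixing SL_le.
(* With [t], [u], [y] standing for [q], [q ^ (n - 1)] and [q ^ (n ^ 2 - n - 1)], every power of [q]
   involved is a monomial and truncated subtraction disappears. *)
pose t : R := q%:R; pose u : R := t ^+ m; pose y : R := t ^+ (m ^ 2 + m - 1).
have t_gt0 : 0 < t by rewrite ltr0n ltnW.
have u_gt0 : 0 < u by rewrite exprn_gt0.
have y_gt0 : 0 < y by rewrite exprn_gt0.
have EE : t ^+ (m ^ 2 + 2 * m) = u * t * y.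
  by rewrite -exprSr -exprD; congr (_ ^+ _); lia.
have QE : t ^+ (m + m ^ 2) = t * y.
  by rewrite -exprS; congr (_ ^+ _); lia.
have NE : t ^+ (m.+1 ^ 2) = t ^+ 2 * u * y.
  by rewrite -!exprD; congr (_ ^+ _); rewrite -!mulnn; lia.
have -> : q%:R ^+ (m.+1 ^ 2) = t ^+ 2 * u * y :> R := NE.
have -> : q%:R ^+ (2 * m.+1) = t ^+ 2 * u ^+ 2 :> R.
  by rewrite -exprM -exprD; congr (_ ^+ _); lia.
have -> : q%:R ^+ (4 * m.+1 ^ 2 - 4 * m.+1 - 2) = t ^+ 2 * y ^+ 4 :> R.
  by rewrite -exprM -exprD; congr (_ ^+ _); rewrite -!mulnn; lia.
have -> : q%:R ^+ (m.+1 ^ 2 - m.+1 - 1) = y :> R.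
  by congr (_ ^+ _); rewrite -!mulnn; lia.
set a : R := #|A|%:R; set P : R := #|B|%:R * #|C|%:R; set x : R := #|X|%:R.
have a_ge0 : 0 <= a := ler0n R _.
have P_ge0 : 0 <= P by rewrite mulr_ge0 ?ler0n.
have x_ge0 : 0 <= x := ler0n R _.
have s_ge0 : 0 <= s%:R :> R := ler0n R _.
have -> : a * #|B|%:R ^+ 2 * #|C|%:R ^+ 2 = a * P ^+ 2 by rewrite /P; ring.
have size_X : alpha * (u * t * y) <= x \/ alpha * P <= x * (t * y).
  case/orP: growth; rewrite -(ler_nat R) => growth; [left|right].
    rewrite natrM !natrX -/t EE in growth.
    rewrite ler_pdivrMl ?exprn_gt0 // (le_trans growth) // ler_wpM2r //.
    by rewrite ler_eXn2l ?ltr1n //; lia.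
  rewrite !natrM !natrX -/t EE in growth.
  have {}growth : P <= 8%:R * (x * (t * y)).
    by rewrite -(ler_pM2l u_gt0) (le_trans growth) // le_eqVlt; apply/orP; left; apply/eqP; ring.
  rewrite ler_pdivrMl ?exprn_gt0 // (le_trans growth) // ler_wpM2r //.
    by rewrite !mulr_ge0 // ltW.
  by rewrite -[8%:R]/((2 ^ 3)%:R) natrX ler_eXn2l ?ltr1n // !ltnS ltnW.
have size_S : t * x <= 4%:R * s%:R \/ a * x ^+ 2 <= 16%:R * y ^+ 2 * s%:R.
  case/orP: mixing; rewrite -(ler_nat R) !natrM !natrX -/t ?NE ?QE => mixing; [left|right].
    move: SL_le; rewrite -(ler_nat R) natrM natrX -/t EE => SL_le.
    have uty_gt0 : 0 < u * t * y by rewrite !mulr_gt0.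
    rewrite -(ler_pM2l uty_gt0).
    apply: le_trans (_ : 2%:R * G%:R * s%:R <= _); last first.
      apply: le_trans (_ : 2%:R * (2%:R * (u * t * y)) * s%:R <= _).
        by rewrite ler_wpM2r // ler_wpM2l ?ler0n.
      by rewrite le_eqVlt; apply/orP; left; apply/eqP; ring.
    by apply: le_trans mixing; rewrite le_eqVlt; apply/orP; left; apply/eqP; ring.
  rewrite -(ler_pM2l (exprn_gt0 2 t_gt0)) (le_trans mixing) //.
  by rewrite le_eqVlt; apply/orP; left; apply/eqP; ring.
set c := alpha ^+ 2 / 16%:R.
have c_ge0 : 0 <= c by rewrite divr_ge0 ?exprn_ge0 // ltW.
have c_le : c <= alpha / 4%:R.
  have : alpha ^+ 2 <= alpha by rewrite expr2 ger_pMl.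
  rewrite /c; move: alpha_gt0; lra.
have below (z : R) : c * z <= s%:R -> forall w, w <= z -> c * w <= s%:R.
  by move=> cz w wz; rewrite (le_trans _ cz) // ler_wpM2l.
(* The four cases reach, in order, the first, fourth, second and third term of the minimum; [below]
   then passes from that term to the minimum. *)
case: size_S => hS; case: size_X => hX.
- apply: (below (t ^+ 2 * u * y)); last by rewrite ge_min lexx.
  apply: le_trans (_ : alpha / 4%:R * (t ^+ 2 * u * y) <= _).
    by rewrite ler_wpM2r // !mulr_ge0 ?exprn_ge0 // ltW.
  have := ler_wpM2l (ltW t_gt0) hX; move: hS; lra.
- apply: (below (P / y)); last by rewrite !ge_min lexx !orbT.
  apply: le_trans (_ : alpha / 4%:R * (P / y) <= _).
    by rewrite ler_wpM2r // divr_ge0 // ltW.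
  rewrite mulrA ler_pdivrMr //; have := ler_wpM2l (ltW y_gt0) hS; move: hX; lra.
- apply: (below (t ^+ 2 * u ^+ 2 * a)); last by rewrite !ge_min lexx !orbT.
  have y2_gt0 : 0 < y ^+ 2 by rewrite exprn_gt0.
  have hX2 : (alpha * (u * t * y)) ^+ 2 <= x ^+ 2.
    by rewrite lerXn2r // nnegrE !mulr_ge0 // ltW.
  rewrite -(ler_pM2l y2_gt0) /c; have := ler_wpM2l a_ge0 hX2; move: hS.
  have -> : y ^+ 2 * (alpha ^+ 2 / 16%:R * (t ^+ 2 * u ^+ 2 * a)) =
    a * (alpha * (u * t * y)) ^+ 2 / 16%:R by field.
  lra.
- apply: (below (a * P ^+ 2 / (t ^+ 2 * y ^+ 4))); last by rewrite !ge_min lexx !orbT.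
  have ty_gt0 : 0 < t * y by rewrite mulr_gt0.
  have hX2 : (alpha * P) ^+ 2 <= (x * (t * y)) ^+ 2.
    by rewrite lerXn2r // nnegrE !mulr_ge0 // ltW.
  rewrite mulrA ler_pdivrMr ?mulr_gt0 ?exprn_gt0 // /c.
  have := ler_wpM2l a_ge0 hX2; have := ler_wpM2r (exprn_ge0 2 (ltW ty_gt0)) hS.
  have -> : alpha ^+ 2 / 16%:R * (a * P ^+ 2) = a * (alpha * P) ^+ 2 / 16%:R by field.
  have -> : a * (x * (t * y)) ^+ 2 = a * x ^+ 2 * (t * y) ^+ 2 by ring.
  have -> : 16%:R * y ^+ 2 * s%:R * (t * y) ^+ 2 = 16%:R * (s%:R * (t ^+ 2 * y ^+ 4)) by ring.
  lra.
Qed.
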